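(* Let $(G,H)=(\mathrm U(p,q),\mathrm U(p_1,q_1)\times\mathrm U(p-p_1,q-q_1))$ with $0<p_1<p$, $0<q_1<q$, and let $0\le r\le\min\{p,q\}$. (1) When $r<\min\{p_1,q-q_1\}+\min\{q_1,p-p_1\}$, the open $H$-orbits in $\mathrm{Gr}_G(r)$ are not unique, and they are given by $\mathcal O(0,0,0,b_U,b_W)$, where $b_U+b_W=r$, $0\le b_U\le\min\{p_1,q-q_1\}$ and $0\le b_W\le\min\{q_1,p-p_1\}$. (2) When $\min\{p_1,q-q_1\}+\min\{q_1,p-p_1\}\le r\le\min\{p,q\}$, there is a unique open $H$-orbit in $\mathrm{Gr}_G(r)$, given by $$\begin{cases}\mathcal O(r-b_U-b_W,\,0,\,0,\,b_U,\,b_W)&\text{if }\dim U>\dim W,\\ \mathcal O(0,\,r-b_U-b_W,\,0,\,b_U,\,b_W)&\text{if }\dim U\le\dim W,\end{cases}$$ where $b_U=\min\{p_1,q-q_1\}$ and $b_W=\min\{q_1,p-p_1\}$.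
   Context: $V=\mathbb C^{p+q}$ has a nondegenerate Hermitian form $B$ of signature $(p,q)$; $V=U\oplus W$ with $U\perp W$, $B|_U$ of signature $(p_1,q_1)$ and $B|_W$ of signature $(p-p_1,q-q_1)$. $G$ is the isometry group of $V$ and $H$ the product of the isometry groups of $U$ and $W$. $\mathrm{Gr}_G(r)$ is the projective variety of $r$-dimensional complex subspaces $S$ of $V$ with $S\perp S$. Dimensions of subspaces and of their quotients are complex dimensions. For a subspace $X$, $\mathrm{Rad}(X)=X\cap X^\perp$; $\mathbf P_US=(S+W)\cap U$, $\mathbf P_WS=(S+U)\cap W$. For $S\in\mathrm{Gr}_G(r)$: $r_U(S)=\dim(S\cap U)$, $r_W(S)=\dim(S\cap W)$, $a(S)=\dim\frac{\mathrm{Rad}(\mathbf P_US)}{S\cap U}=\dim\frac{\mathrm{Rad}(\mathbf P_WS)}{S\cap W}$, and $b_U(S)$ (resp. $b_W(S)$) is the dimension of a maximal positive definite (resp. negative definite) subspace of $\mathbf P_US$. The 5-tuple $(r_U(S),r_W(S),a(S),b_U(S),b_W(S))$ determines the $H$-orbit of $S$; $\mathcal O(r_U,r_W,a,b_U,b_W)$ denotes the $H$-orbit with this 5-tuple.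
   Formalization: In (1), the clause that the open H-orbits are not unique is stated only for r > 0: for r = 0 the variety Gr_G(0) is a single point, so there is exactly one open orbit; the description of the open orbits is kept for r = 0. *)

(* Defs.v *)
From HB Require Import structures.
From mathcomp Require Import all_boot all_order all_algebra.
From mathcomp Require Import sesquilinear complex.
From mathcomp Require Import all_classical all_reals all_analysis.

Set Implicit Arguments.
Unset Strict Implicit.
Unset Printing Implicit Defensive.

Import Order.TTheory GRing.Theory Num.Theory.
Import numFieldNormedType.Exports.
Local Open Scope classical_set_scope.
Local Open Scope ring_scope.

(* [R[i]] has no topology of its own in the library; packing it as a
   [numClosedFieldType] gives it the one induced by the modulus, and gives
   matrices over it the product topology. *)
Definition Cplx (R : realType) : numClosedFieldType := R[i]%C.

Section HermitianSpace.
Variables (C : numClosedFieldType) (vT : vectType C).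
Variable B : {hermitian vT for false & Num.conj}.
Implicit Types (X P S U W : {vspace vT}) (h : 'End(vT)).

Definition posdef X := {in X, forall v, v != 0 -> 0 < B v v}.
Definition negdef X := {in X, forall v, v != 0 -> B v v < 0}.

(* Largest dimension of a positive (resp. negative) definite subspace of [X];
   it is well defined for degenerate [X] too. *)
Definition posindex X : nat :=
  (\max_(d < (\dim X).+1 |
      `[< exists P, [/\ (P <= X)%VS, \dim P = d & posdef P] >]) d)%N.
Definition negindex X : nat :=
  (\max_(d < (\dim X).+1 |
      `[< exists P, [/\ (P <= X)%VS, \dim P = d & negdef P] >]) d)%N.

Definition has_signature X (s t : nat) :=
  [/\ \dim X = (s + t)%N, posindex X = s & negindex X = t].

Definition radical X : {vspace vT} := (X :&: orthov B X)%VS.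

Definition Gr (r : nat) : set {vspace vT} :=
  [set S | \dim S = r /\ (S <= orthov B S)%VS].

(* [proj X Y S] is the projection of [S] to [X] along [Y]: the P_U S of the
   paper is [proj U W S], and P_W S is [proj W U S]. *)
Definition proj X Y S : {vspace vT} := ((S + Y) :&: X)%VS.

Definition rU U S : nat := \dim (S :&: U).
Definition rW W S : nat := \dim (S :&: W).

(* For isotropic [S] one has [S :&: U <= radical (proj U W S)], so the
   truncated subtraction is the dimension of the quotient; exchanging the roles
   of [U] and [W] gives the same number. *)
Definition aS U W S : nat := (\dim (radical (proj U W S)) - \dim (S :&: U))%N.

(* Both indices are taken on the projection to [U]. *)
Definition bU U W S : nat := posindex (proj U W S).
Definition bW U W S : nat := negindex (proj U W S).

Definition isometry_of X h :=
  (h @: X)%VS = X /\ {in X &, forall x y, B (h x) (h y) = B x y}.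

(* When the space is the direct sum of [U] and [W], these are the block
   diagonal maps made of an isometry of [U] and an isometry of [W]. *)
Definition inH U W : set 'End(vT) :=
  [set h | isometry_of U h /\ isometry_of W h].

Definition Horbit U W S : set {vspace vT} :=
  [set (h @: S)%VS | h in inH U W].

(* The set of points of [Gr r] with given invariants; that it is a single
   [H]-orbit is not built in. *)
Definition Orb U W (r rU0 rW0 a0 bU0 bW0 : nat) : set {vspace vT} :=
  [set S | Gr r S /\
    [/\ rU U S = rU0, rW W S = rW0, aS U W S = a0,
        bU U W S = bU0 & bW U W S = bW0]].

End HermitianSpace.

Section Topology.
Variables (C : numClosedFieldType) (n : nat).
Variable B : {hermitian 'rV[C]_n for false & Num.conj}.

Definition rowspan (r : nat) (A : 'M[C]_(r, n)) : {vspace 'rV[C]_n} :=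
  <<codom (fun i => row i A)>>%VS.

(* Openness of a subset [O] of [Gr B r] in the analytic topology, i.e. the
   quotient topology from frames: the frames of the points of [Gr B r] form a
   subspace of the r x n matrices, and the frames of points of [O] must be
   relatively open in it. (A matrix whose row span lies in [Gr B r] has
   independent rows.) *)
Definition open_in_Gr (r : nat) (O : set {vspace 'rV[C]_n}) :=
  O `<=` Gr B r /\
  exists2 D : set 'M[C]_(r, n), open D &
    @rowspan r @^-1` O = @rowspan r @^-1` Gr B r `&` D.

Definition open_Horbits (U W : {vspace 'rV[C]_n}) (r : nat) :
    set (set {vspace 'rV[C]_n}) :=
  [set O | open_in_Gr r O /\ exists2 S, Gr B r S & O = Horbit B U W S].

End Topology.

(* Main.v *)
Require Import Defs.
From HB Require Import structures.
From mathcomp Require Import all_boot all_order all_algebra.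
From mathcomp Require Import sesquilinear complex.
From mathcomp Require Import all_classical all_reals all_analysis.
From mathcomp Require Import ring zify.

(* Write P_U S for the projection of S to U, and (b_U, b_W) for its signature.
   Since S is isotropic, P_W S has the opposite signature, so b_U and b_W are at
   most m_U and m_W. Both are lower semicontinuous in S.

   If b_U + b_W is smaller than r, dim U and dim W, then S is moved by the
   transvections v |-> v + i t B(v, e) e to nearby isotropic subspaces with a
   larger value of b_U + b_W, where e = u + w is isotropic, orthogonal to the
   nondegenerate part of S and not orthogonal to the rest of S, with u in U not
   isotropic. Such an orbit is not open. As r <= min(p, q), the minimum of
   r, dim U and dim W is that of r and m_U + m_W, so that open orbits have
   either b_U + b_W = r or (b_U, b_W) = (m_U, m_W).

   Conversely each of these conditions defines an open set, which is a single
   orbit: S is spanned by sums of a vector of norm 1 and a vector of norm -1,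
   taken from orthonormal bases of U and W, in a pattern that depends only on
   the invariants. *)

Import Order.TTheory GRing.Theory Num.Theory.
Import numFieldNormedType.Exports.
Local Open Scope classical_set_scope.
Local Open Scope ring_scope.

Set Implicit Arguments.
Unset Strict Implicit.
Unset Printing Implicit Defensive.

(** Choosing one term in each of the minima m_U and m_W gives the sums dim U, p, q and dim W, so m_U
    + m_W = min(dim U, dim W, p, q). Hence, when m_U + m_W < r <= min(p, q), the smaller summand has
    dimension m_U + m_W and is filled by the projection of an S of maximal indices; what remains of
    S lies in the larger one. This is the origin of the distinction between dim U and dim W.

    The delicate part of S is the one above the radical of P_U S. With X and Y the two summands in
    some order, the normal form concerns the S that meet Y in 0 and for which the radical of the
    projection to X is [S :&: X]: a basis of that intersection splits into hyperbolic pairs of X.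
    Any other S has a submaximal value of b_U + b_W.

    Deformations have to preserve isotropy. Transvections are isometries of V and affine in t, so
    they move a frame along a line of matrices, and the norm of the vector gained by the projection
    is a quadratic polynomial in t without constant term, nonzero except at 0 and at most one
    further value. *)

Local Notation proj := Defs.proj.

(** * Frames *)

Section Frames.
Variables (C : numClosedFieldType) (vT : vectType C).
Variable B : {hermitian vT for false & Num.conj}.
Implicit Types (u v w x y : vT) (X Y S U W : {vspace vT}) (P N F Z : seq vT).

Lemma herm_sym u v : B u v = (B v u)^*.
Proof. by rewrite hermC expr0 mul1r. Qed.

Lemma hermDl u v w : B (u + v) w = B u w + B v w.
Proof. exact: linearDl. Qed.

Lemma hermDr u v w : B u (v + w) = B u v + B u w.
Proof. exact: linearDr. Qed.

Lemma hermBl u v w : B (u - v) w = B u w - B v w.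
Proof. exact: linearBl. Qed.

Lemma hermBr u v w : B u (v - w) = B u v - B u w.
Proof. exact: linearBr. Qed.

Lemma hermZl a u v : B (a *: u) v = a * B u v.
Proof. exact: linearZl_LR. Qed.

Lemma hermZr a u v : B u (a *: v) = a^* * B u v.
Proof. exact: linearZr_LR. Qed.

Definition hermE := (hermBl, hermBr, hermDl, hermDr, hermZl, hermZr).

Lemma herm0l u : B 0 u = 0. Proof. exact: linear0l. Qed.

Lemma herm_suml I (r : seq I) (p : pred I) (f : I -> vT) v :
  B (\sum_(i <- r | p i) f i) v = \sum_(i <- r | p i) B (f i) v.
Proof. exact: linear_sumlz. Qed.

Lemma herm_sumr I (r : seq I) (p : pred I) (f : I -> vT) v :
  B v (\sum_(i <- r | p i) f i) = \sum_(i <- r | p i) B v (f i).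
Proof. exact: linear_sumr. Qed.

Lemma herm_real v : B v v \is Num.real.
Proof. by apply/CrealP; rewrite -herm_sym. Qed.

Lemma herm0C u v : B u v = 0 -> B v u = 0.
Proof. by rewrite (herm_sym v) => ->; rewrite rmorph0. Qed.

Lemma orth_span F v : {in F, forall x, B v x = 0} -> {in <<F>>%VS, forall u, B v u = 0}.
Proof.
move=> oF u uF; apply: herm0C; apply/eqP; rewrite -mem_orthov1.
apply: (subvP _ _ uF); apply/span_subvP => x xF.
by rewrite mem_orthov1; apply/eqP/herm0C/oF.
Qed.

Lemma oseq_orth_span x F : all (fun v => B x v == 0) F ->
  {in <<F>>%VS, forall u, B u x = 0}.
Proof.
move=> /allP oF u uF; apply/herm0C/(orth_span _ uF) => y yF.
exact/eqP/oF.
Qed.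

Lemma isotropic_polar X : {in X, forall v, B v v = 0} -> {in X &, forall u v, B u v = 0}.
Proof.
move=> isoX u v uX vX.
(* The norm of [B u v *: v + u] is 2|B(u, v)|^2. *)
have := isoX _ (memvD (memvZ (B u v) vX) uX).
rewrite !hermE !isoX // (herm_sym v u) !(mulr0, add0r, addr0) [_^* * _]mulrC.
move/eqP; rewrite -mulr2n mulrn_eq0 /= mulf_eq0 conjC_eq0 orbb.
by move/eqP.
Qed.

Local Notation orth := (fun u v => B u v == 0).

Lemma orthC : symmetric orth.
Proof. by move=> u v /=; rewrite herm_sym conjC_eq0. Qed.

Definition oseq F := pairwise orth F.

Lemma oseq_cat F G : oseq (F ++ G) = [&& allrel orth F G, oseq F & oseq G].
Proof. exact: pairwise_cat. Qed.

Lemma allrel_orthC F G : allrel orth F G = allrel orth G F.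
Proof. by rewrite allrelC; apply: eq_allrel => u v; apply: orthC. Qed.

Lemma oseq_perm F G : perm_eq F G -> oseq F -> oseq G.
Proof.
move: F G; apply: (catCA_perm_ind (P := oseq)) => F G H.
rewrite !oseq_cat !allrel_catr => /and3P[/andP[FG ->] -> /and3P[-> -> ->]].
by rewrite !andbT allrel_orthC.
Qed.

Lemma oseq_cons x F : oseq (x :: F) = all (orth x) F && oseq F.
Proof. exact: pairwise_cons. Qed.

Definition oproj F v : vT := \sum_(x <- F) (B v x / B x x) *: x.

Lemma oproj_span F v : oproj F v \in <<F>>%VS.
Proof.
rewrite /oproj big_seq memv_suml // => x xF.
by rewrite memvZ ?memv_span.
Qed.

Definition aniso F := all (fun v => B v v != 0) F.

Lemma oproj_orth F v : oseq F -> aniso F -> {in F, forall y, B (v - oproj F v) y = 0}.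
Proof.
elim: F => [|x F IH]; first by [].
rewrite oseq_cons /= => /andP[/allP oxF oF] /andP[nx nF] y.
rewrite /oproj big_cons -/(oproj F v) inE => /orP[/eqP->|yF].
  rewrite hermBl hermDl hermZl divfK // (oseq_orth_span _ (oproj_span F v)).
    by rewrite addr0 subrr.
  exact/allP.
rewrite opprD addrA (addrAC v) hermBl IH // hermZl sub0r.
by move/eqP: (oxF _ yF) => ->; rewrite mulr0 oppr0.
Qed.

Lemma oseq_span_orth0 F v : oseq F -> aniso F -> v \in <<F>>%VS ->
  {in F, forall y, B v y = 0} -> v = 0.
Proof.
elim: F v => [|x F IH] v; first by rewrite span_nil memv0 => _ _ /eqP.
rewrite oseq_cons /= => /andP[oxF oF] /andP[nx nF].
rewrite span_cons => /memv_addP[_ /vlineP[k ->]] [w wF ->] o.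
have := o x (mem_head _ _).
rewrite hermDl hermZl (oseq_orth_span oxF wF) addr0 => /eqP.
rewrite mulf_eq0 (negPf nx) orbF => /eqP k0.
rewrite k0 scale0r add0r in o *; apply: IH => // y yF.
by apply: o; rewrite inE yF orbT.
Qed.

Lemma oseq_free F : oseq F -> aniso F -> free F.
Proof.
elim: F => [|x F IH]; first by rewrite nil_free.
rewrite oseq_cons free_cons /= => /andP[oxF oF] /andP[nx nF].
rewrite IH // andbT; apply/negP => /(oseq_orth_span oxF) x0.
by rewrite x0 eqxx in nx.
Qed.

Lemma oproj_id F v : oseq F -> aniso F -> v \in <<F>>%VS -> oproj F v = v.
Proof.
move=> oF nF vF; apply/eqP; rewrite eq_sym -subr_eq0; apply/eqP.
apply: (oseq_span_orth0 oF nF); last exact: oproj_orth.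
by rewrite memvB // oproj_span.
Qed.

Lemma isometry_span (h : 'End(vT)) F :
  oseq F -> oseq (map h F) -> {in F, forall x, B (h x) (h x) = B x x} ->
  {in <<F>>%VS &, forall u v, B (h u) (h v) = B u v}.
Proof.
elim: F => [|x F IH].
  by move=> _ _ _ u v; rewrite span_nil !memv0 => /eqP-> /eqP->; rewrite linear0 !herm0l.
rewrite map_cons !oseq_cons => /andP[oxF oF] /andP[ohxF ohF] hF u v.
rewrite span_cons => /memv_addP[_ /vlineP[a ->]] [u' u'F ->].
move=> /memv_addP[_ /vlineP[b ->]] [v' v'F ->].
have img w : w \in <<F>>%VS -> h w \in <<map h F>>%VS.
  by rewrite -limg_span; apply: memv_img.
have hF' : {in F, forall y, B (h y) (h y) = B y y}.
  by move=> y yF; rewrite hF // inE yF orbT.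
rewrite !linearD !linearZ /= !hermE hF ?mem_head // (IH _ _ _ u' v') //.
rewrite (oseq_orth_span oxF u'F) (oseq_orth_span ohxF (img _ u'F)).
rewrite (herm0C (oseq_orth_span oxF v'F)).
by rewrite (herm0C (oseq_orth_span ohxF (img _ v'F))).
Qed.

(** Riesz representation in an orthogonal basis; the coefficients are conjugated because [B] is
    semilinear in its second argument. *)
Lemma herm_repr F (f : {scalar vT}) : oseq F -> aniso F ->
  exists2 x, x \in <<F>>%VS & {in <<F>>%VS, forall v, B v x = f v}.
Proof.
move=> oF nF; exists (\sum_(y <- F) ((f y)^* / B y y) *: y).
  by rewrite big_seq memv_suml // => y yF; rewrite memvZ ?memv_span.
move=> v vF; rewrite herm_sumr -[in RHS](oproj_id oF nF vF) /oproj linear_sum.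
apply: eq_bigr => y _; rewrite hermZr linearZ /= rmorphM /= conjCK fmorphV /= -herm_sym.
by rewrite mulrAC -mulrA mulrC.
Qed.

Definition frame P N :=
  [&& oseq (P ++ N), all (fun v => B v v == 1) P & all (fun v => B v v == -1) N].

Lemma frame_aniso P N : frame P N -> aniso (P ++ N).
Proof.
case/and3P=> _ /allP p /allP n; rewrite /aniso all_cat; apply/andP; split; apply/allP => v.
  by move/p/eqP->; rewrite oner_eq0.
by move/n/eqP->; rewrite oppr_eq0 oner_eq0.
Qed.

Lemma frame_oseq P N : frame P N -> oseq (P ++ N).
Proof. by case/and3P. Qed.

Lemma frame_free P N : frame P N -> free (P ++ N).
Proof. by move=> f; apply: oseq_free; [apply: frame_oseq|apply: frame_aniso]. Qed.

Lemma frame_perm P N P' N' : perm_eq P P' -> perm_eq N N' -> frame P N -> frame P' N'.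
Proof.
move=> pP pN /and3P[oF p n]; apply/and3P; split.
- by apply: oseq_perm oF; apply: perm_cat.
- by rewrite -(perm_all _ pP).
- by rewrite -(perm_all _ pN).
Qed.

Lemma frame_cat P N P' N' : frame (P ++ P') (N ++ N') =
  [&& frame P N, frame P' N' & allrel orth (P ++ N) (P' ++ N')].
Proof.
rewrite /frame !all_cat !oseq_cat !allrel_catl !allrel_catr (allrel_orthC P' N).
move: (allrel _ P P') (allrel _ P N) (allrel _ P N') (allrel _ N P') => a1 a2 a3 a4.
move: (allrel _ N N') (allrel _ P' N') (oseq P) (oseq P') => a5 a6 a7 a8.
move: (oseq N) (oseq N') (all _ P) (all _ P') (all _ N) (all _ N') => b1 b2 b3 b4 b5 b6.
apply/idP/idP.
  case/and4P=> /and5P[/and3P[/andP[-> ->] -> ->] /and3P[-> -> ->] -> -> ->].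
  by case/andP=> -> -> -> ->.
case/and3P=> /and3P[/and3P[-> -> ->] -> ->] /and3P[/and3P[-> -> ->] -> ->].
by case/and3P=> /andP[-> ->] -> ->.
Qed.

Lemma frame_sub P N P' N' : subseq P P' -> subseq N N' -> frame P' N' -> frame P N.
Proof.
move=> sP sN /and3P[oF p n]; apply/and3P; split.
- by apply: subseq_pairwise oF; apply: cat_subseq.
- by apply/allP => x /(mem_subseq sP) /(allP p).
- by apply/allP => x /(mem_subseq sN) /(allP n).
Qed.

(* The two projections of an isotropic subspace are such [f] and [g]. *)
Lemma frame_map_anti (f g : vT -> vT) P N :
  {in P ++ N &, forall u v, B (f u) (f v) = - B (g u) (g v)} ->
  frame (map f P) (map f N) -> frame (map g N) (map g P).
Proof.
move=> fg /and3P[oF p n].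
have eqg u v : u \in P ++ N -> v \in P ++ N -> B (g u) (g v) = - B (f u) (f v).
  by move=> uF vF; rewrite fg // opprK.
apply/and3P; split.
- rewrite -map_cat; apply: (@oseq_perm (map g (P ++ N))).
    by rewrite perm_map // perm_catC.
  move: oF; rewrite -map_cat /oseq !pairwise_map.
  congr (is_true _); apply: (@eq_in_pairwise _ [in P ++ N]); last by apply/allP.
  by move=> u v uF vF /=; rewrite /relpre /= eqg // oppr_eq0.
- rewrite all_map; apply/allP => v vN /=; rewrite eqg ?mem_cat ?vN ?orbT //.
  by move: n; rewrite all_map => /allP /(_ _ vN) /= /eqP ->; rewrite opprK.
- rewrite all_map; apply/allP => v vP /=; rewrite eqg ?mem_cat ?vP //.
  by move: p; rewrite all_map => /allP /(_ _ vP) /= /eqP ->.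
Qed.

Lemma frame_map (f : vT -> vT) P N :
  {in P ++ N &, forall u v, B (f u) (f v) = B u v} ->
  frame P N -> frame (map f P) (map f N).
Proof.
move=> fg /and3P[oF p n]; apply/and3P; split.
- move: oF; rewrite -map_cat /oseq !pairwise_map.
  congr (is_true _); apply: (@eq_in_pairwise _ [in P ++ N]); last by apply/allP.
  by move=> u v uF vF /=; rewrite /relpre /= fg.
- rewrite all_map; apply/allP => v vP /=; rewrite fg ?mem_cat ?vP //.
  exact: (allP p).
- rewrite all_map; apply/allP => v vN /=; rewrite fg ?mem_cat ?vN ?orbT //.
  exact: (allP n).
Qed.

End Frames.

(** * Signatures *)

Section Indices.
Variables (C : numClosedFieldType) (vT : vectType C).
Variable B : {hermitian vT for false & Num.conj}.
Implicit Types (u v w x y : vT) (X Y S U W Q : {vspace vT}) (P N F Z : seq vT).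

Lemma mem_radicalP X v :
  reflect (v \in X /\ {in X, forall u, B v u = 0}) (v \in radical B X).
Proof.
rewrite memv_cap; apply: (iffP andP) => -[vX oX]; split => //.
  exact/mem_orthovP.
exact/mem_orthovP.
Qed.

(** A maximal frame of a possibly degenerate [X]: it spans a complement of the radical. *)
Definition complete X P N :=
  [/\ frame B P N, {subset P ++ N <= X} &
      {in X, forall v, {in P ++ N, forall y, B v y = 0} -> v \in radical B X}].

Lemma frame_size X P N : frame B P N -> {subset P ++ N <= X} ->
  (size P + size N <= \dim X)%N.
Proof.
move=> fPN /span_subvP PNX; rewrite -size_cat.
by rewrite -(eqnP (frame_free fPN)) dimvS.
Qed.

Lemma normalize v : B v v != 0 ->
  exists c : C, [/\ c != 0 & B (c *: v) (c *: v) = 1 \/ B (c *: v) (c *: v) = -1].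
Proof.
move=> nv; exists (sqrtC `|B v v|)^-1; split.
  by rewrite invr_eq0 sqrtC_eq0 normr_eq0.
have c_real : (sqrtC `|B v v|)^-1 \is Num.real.
  by rewrite rpredV ger0_real // sqrtC_ge0.
rewrite !hermE (conj_Creal c_real) mulrA -expr2 exprVn sqrtCK.
have /orP[vv|vv] := real_leVge (real0 _) (herm_real B v).
  by left; rewrite ger0_norm // mulVf.
by right; rewrite ler0_norm // invrN mulNr mulVf.
Qed.

Lemma frame_rcons_pos P N v : frame B P N -> B v v = 1 ->
  {in P ++ N, forall y, B v y = 0} -> frame B (P ++ [:: v]) N.
Proof.
move=> fPN vv vo; rewrite -[N]cats0 frame_cat fPN /=; apply/andP; split.
  by rewrite /frame /= vv eqxx.
rewrite allrel1r; apply/allP => y yF /=; apply/eqP/herm0C; exact: vo.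
Qed.

Lemma frame_rcons_neg P N v : frame B P N -> B v v = -1 ->
  {in P ++ N, forall y, B v y = 0} -> frame B P (N ++ [:: v]).
Proof.
move=> fPN vv vo; rewrite -[P]cats0 frame_cat fPN /=; apply/andP; split.
  by rewrite /frame /= vv eqxx.
rewrite allrel1r; apply/allP => y yF /=; apply/eqP/herm0C; exact: vo.
Qed.

(** Gram-Schmidt for an indefinite form: while [X] contains a non-isotropic vector orthogonal to the
    frame, it is normalized and added. When there is none, the vectors of [X] orthogonal to the
    frame are orthogonal to each other by polarization, and so lie in the radical. *)
Lemma frame_ext X P N : frame B P N -> {subset P ++ N <= X} ->
  exists P' N', complete X (P ++ P') (N ++ N').
Proof.
have [k] := ubnP (\dim X - (size P + size N)).
elim: k P N => // k IH P N; rewrite ltnS => lek fPN sX.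
have [[v [vX vo nv]]|none] := pselect
    (exists v, [/\ v \in X, {in P ++ N, forall y, B v y = 0} & B v v != 0]).
  have [c [_ norm_v]] := normalize nv.
  have cX : c *: v \in X by apply: memvZ.
  have co : {in P ++ N, forall y, B (c *: v) y = 0}.
    by move=> y yF; rewrite hermZl vo ?mulr0.
  have : exists P1 N1, [/\ frame B (P ++ P1) (N ++ N1),
      {subset (P ++ P1) ++ N ++ N1 <= X} & size P1 + size N1 = 1%N]%N.
    case: norm_v => nv1.
      exists [:: c *: v], [::]; rewrite cats0; split => //; first exact: frame_rcons_pos.
      move=> y; rewrite !mem_cat inE => /orP[/orP[yP|/eqP->//]|yN].
        by rewrite sX // mem_cat yP.
      by rewrite sX // mem_cat yN orbT.
    exists [::], [:: c *: v]; rewrite cats0; split => //; first exact: frame_rcons_neg.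
    move=> y; rewrite !mem_cat inE => /orP[yP|/orP[yN|/eqP->//]].
      by rewrite sX // mem_cat yP.
    by rewrite sX // mem_cat yN orbT.
  case=> P1 [N1 [f1 s1 size1]].
  have sz := frame_size f1 s1; rewrite !size_cat in sz.
  have [|P2 [N2 c2]] := IH (P ++ P1) (N ++ N1) _ f1 s1.
    by rewrite !size_cat; lia.
  by exists (P1 ++ P2), (N1 ++ N2); rewrite !catA.
exists [::], [::]; rewrite !cats0; split => // v vX vo.
have oF := frame_oseq fPN; have nF := frame_aniso fPN.
have iso0 : {in (X :&: orthov B <<P ++ N>>)%VS, forall u, B u u = 0}.
  move=> u /memv_capP[uX /mem_orthovP uo]; apply/eqP/negPn/negP => nu.
  apply: none; exists u; split=> // y yF; exact/uo/memv_span.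
have in_iso u : u \in X -> {in P ++ N, forall y, B u y = 0} ->
    u \in (X :&: orthov B <<P ++ N>>)%VS.
  move=> uX uo; apply/memv_capP; split=> //; apply/mem_orthovP => y.
  exact: orth_span.
apply/mem_radicalP; split=> // u uX.
have spF : oproj B (P ++ N) u \in <<P ++ N>>%VS by apply: oproj_span.
have spX : oproj B (P ++ N) u \in X.
  by apply: (subvP _ _ spF); apply/span_subvP.
rewrite -[u](subrK (oproj B (P ++ N) u)) hermDr (orth_span vo spF) addr0.
apply: (isotropic_polar iso0); apply: in_iso => //; first exact: memvB.
exact: oproj_orth.
Qed.

Lemma complete_ex X : exists P N, complete X P N.
Proof. exact: (@frame_ext X [::] [::]). Qed.

Lemma complete_decomp X P N : complete X P N ->
  [/\ (<<P ++ N>> + radical B X)%VS = X, (<<P ++ N>> :&: radical B X = 0)%VS &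
      \dim X = (size P + size N + \dim (radical B X))%N].
Proof.
case=> fPN sX rX; have oF := frame_oseq fPN; have nF := frame_aniso fPN.
have sumX : (<<P ++ N>> + radical B X)%VS = X.
  apply/eqP; rewrite eqEsubv subv_add capvSl andbT; apply/andP; split.
    exact/span_subvP.
  apply/subvP => v vX; rewrite -[v](subrK (oproj B (P ++ N) v)) addrC.
  apply: memv_add; first exact: oproj_span.
  apply: rX; last exact: oproj_orth.
  rewrite memvB //; apply: (subvP _ _ (oproj_span _ _ _)); exact/span_subvP.
have dis : (<<P ++ N>> :&: radical B X = 0)%VS.
  apply/eqP; rewrite -subv0; apply/subvP => v /memv_capP[vF /mem_radicalP[_ vo]].
  rewrite memv0; apply/eqP/(oseq_span_orth0 oF nF vF) => y /sX; exact: vo.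
split=> //; rewrite -{1}sumX dimv_disjoint_sum // (eqnP (frame_free fPN)).
by rewrite size_cat.
Qed.

(** With [e] equal to 1 or -1, both indices are treated by the same argument. *)
Definition sdef (e : C) X := {in X, forall v, v != 0 -> 0 < e * B v v}.

Definition sindex (e : C) X : nat :=
  (\max_(d < (\dim X).+1 |
      `[< exists Q, [/\ (Q <= X)%VS, \dim Q = d & sdef e Q] >]) d)%N.

Lemma posindexE X : posindex B X = sindex 1 X.
Proof.
apply: eq_bigl => d; apply/asboolP/asboolP => -[P [PX dP pP]]; exists P; split=> //.
  by move=> v vP nv; rewrite mul1r pP.
by move=> v vP nv; rewrite -[B v v]mul1r pP.
Qed.

Lemma negindexE X : negindex B X = sindex (-1) X.
Proof.
apply: eq_bigl => d; apply/asboolP/asboolP => -[P [PX dP pP]]; exists P; split=> //.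
  by move=> v vP nv; rewrite mulN1r oppr_gt0 pP.
by move=> v vP nv; rewrite -oppr_gt0 -mulN1r pP.
Qed.

Lemma sindex_ge e X Q : (Q <= X)%VS -> sdef e Q -> (\dim Q <= sindex e X)%N.
Proof.
move=> QX dQ; have ltQ : (\dim Q < (\dim X).+1)%N by rewrite ltnS dimvS.
apply: (@leq_bigmax_cond _ _ (fun d : 'I_(\dim X).+1 => d : nat) (Ordinal ltQ)).
by apply/asboolP; exists Q.
Qed.

Lemma sindex_ex e X : exists Q, [/\ (Q <= X)%VS, \dim Q = sindex e X & sdef e Q].
Proof.
have zero : `[< exists Q, [/\ (Q <= X)%VS, \dim Q = @ord0 (\dim X) & sdef e Q] >].
  apply/asboolP; exists 0%VS; split; rewrite ?sub0v ?dimv0 // => v.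
  by rewrite memv0 => ->.
have [d /asboolP] := @eq_bigmax_cond _
    (fun d : 'I_(\dim X).+1 => `[< exists Q, [/\ (Q <= X)%VS, \dim Q = d & sdef e Q] >])
    (fun d : 'I_(\dim X).+1 => d : nat) (ltac:(by apply/card_gt0P; exists ord0)).
by case=> Q [QX dQ pQ] eqd; exists Q; rewrite dQ /sindex eqd.
Qed.

Lemma sdef_span e F : oseq B F -> {in F, forall x, 0 < e * B x x} -> sdef e <<F>>%VS.
Proof.
elim: F => [|x F IH]; first by move=> _ _ v; rewrite span_nil memv0 => ->.
rewrite oseq_cons => /andP[oxF oF] pF v.
rewrite span_cons => /memv_addP[_ /vlineP[k ->]] [w wF ->] nz.
have pos_w : w != 0 -> 0 < e * B w w.
  by apply: IH => // y yF; apply: pF; rewrite inE yF orbT.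
rewrite hermDl !hermDr !hermZl !hermZr (oseq_orth_span oxF wF).
rewrite (herm0C (oseq_orth_span oxF wF)) !mulr0 addr0 add0r.
have -> : e * (k * (k^* * B x x) + B w w) = `|k| ^+ 2 * (e * B x x) + e * B w w.
  by rewrite normCK mulrDr; congr (_ + _); ring.
have px := pF x (mem_head _ _).
have [k0|nk] := eqVneq k 0.
  move: nz; rewrite k0 scale0r add0r => /pos_w.
  by rewrite normr0 expr0n mul0r add0r.
have pk : 0 < `|k| ^+ 2 * (e * B x x) by rewrite mulr_gt0 // exprn_gt0 // normr_gt0.
have [->|nw] := eqVneq w 0; first by rewrite herm0l mulr0 addr0.
by rewrite addr_gt0 // pos_w.
Qed.

(** Sylvester's law of inertia: [e] times the form is nonpositive on [Z + radical B X], so this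
    subspace meets every [e]-definite one in 0 and bounds its dimension by that of [Y]. *)
Lemma sindex_eq e X Y (Z : {vspace vT}) : (Y <= X)%VS -> sdef e Y -> sdef (- e) Z ->
  (Z :&: radical B X = 0)%VS -> (Z <= X)%VS ->
  (\dim X <= \dim Y + \dim Z + \dim (radical B X))%N -> sindex e X = \dim Y.
Proof.
move=> YX pY nZ disZ ZX dimX; apply/eqP; rewrite eqn_leq (sindex_ge YX pY) andbT.
have [Q [QX <- pQ]] := sindex_ex e X.
have disQ : (Q :&: (Z + radical B X) = 0)%VS.
  apply/eqP; rewrite -subv0; apply/subvP => v /memv_capP[vQ].
  case/memv_addP=> z zZ [w /mem_radicalP[wX wo] def_v]; rewrite memv0.
  apply/negPn/negP => nv; have := pQ _ vQ nv.
  have zX := subvP ZX _ zZ.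
  rewrite def_v hermDl !hermDr (herm0C (wo z zX)) (wo z zX) (wo w wX) !addr0.
  have [->|/(nZ _ zZ)] := eqVneq z 0; first by rewrite herm0l mulr0 ltxx.
  by rewrite mulNr oppr_gt0 => /lt_trans h /h; rewrite ltxx.
have : (\dim (Q + (Z + radical B X)) <= \dim X)%N.
  by rewrite dimvS // !subv_add QX ZX capvSl.
rewrite dimv_disjoint_sum // dimv_disjoint_sum //; lia.
Qed.

Lemma complete_index X P N : complete X P N ->
  posindex B X = size P /\ negindex B X = size N.
Proof.
move=> cX; have [_ dis dimX] := complete_decomp cX.
case: cX => fPN sX _; have /and3P[oF pP pN] := fPN.
move: (frame_free fPN) => freeF.
move: oF; rewrite oseq_cat => /and3P[_ oP oN].
have dP : \dim <<P>> = size P by apply/eqnP/(catl_free freeF).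
have dN : \dim <<N>> = size N by apply/eqnP/(catr_free freeF).
have sdP : sdef 1 <<P>>%VS.
  by apply: sdef_span => // x /(allP pP) /eqP->; rewrite mul1r ltr01.
have sdN : sdef (- 1) <<N>>%VS.
  by apply: sdef_span => // x /(allP pN) /eqP->; rewrite mulrNN mul1r ltr01.
have PX : (<<P>> <= X)%VS by apply/span_subvP => x xP; rewrite sX // mem_cat xP.
have NX : (<<N>> <= X)%VS by apply/span_subvP => x xN; rewrite sX // mem_cat xN orbT.
have disP : (<<P>> :&: radical B X = 0)%VS.
  apply/eqP; rewrite -subv0 -dis capvS // span_cat addvSl //.
have disN : (<<N>> :&: radical B X = 0)%VS.
  apply/eqP; rewrite -subv0 -dis capvS // span_cat addvSr //.
split.
  by rewrite posindexE (@sindex_eq 1 X <<P>>%VS <<N>>%VS) // dP dN dimX.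
rewrite negindexE (@sindex_eq (-1) X <<N>>%VS <<P>>%VS) // ?opprK //.
by rewrite dP dN dimX (addnC (size P)).
Qed.

Lemma dim_index X : \dim X = (posindex B X + negindex B X + \dim (radical B X))%N.
Proof.
have [P [N cX]] := complete_ex X; have [_ _ dimX] := complete_decomp cX.
by have [-> ->] := complete_index cX.
Qed.

Lemma frame_index X P N : frame B P N -> {subset P ++ N <= X} ->
  (size P <= posindex B X)%N /\ (size N <= negindex B X)%N.
Proof.
move=> fPN sX; have [P' [N' cX]] := frame_ext fPN sX.
by have [-> ->] := complete_index cX; rewrite !size_cat !leq_addr.
Qed.

Lemma posindexS X Y : (X <= Y)%VS -> (posindex B X <= posindex B Y)%N.
Proof.
move=> XY; have [P [N cX]] := complete_ex X; have [-> _] := complete_index cX.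
by case: cX => fPN sX _; apply: (frame_index fPN _).1 => v /sX /(subvP XY).
Qed.

Lemma negindexS X Y : (X <= Y)%VS -> (negindex B X <= negindex B Y)%N.
Proof.
move=> XY; have [P [N cX]] := complete_ex X; have [_ ->] := complete_index cX.
by case: cX => fPN sX _; apply: (frame_index fPN _).2 => v /sX /(subvP XY).
Qed.

Lemma signature_radical X s t : has_signature B X s t -> radical B X = 0%VS.
Proof.
case=> dX pX nX; have := dim_index X; rewrite dX pX nX => dr.
by apply/eqP; rewrite -dimv_eq0; lia.
Qed.

Lemma complete_span X P N : radical B X = 0%VS -> complete X P N -> <<P ++ N>>%VS = X.
Proof. by move=> r0 /complete_decomp[]; rewrite r0 addv0. Qed.

End Indices.

(** * Orthogonal splittings *)

Section Splitting.
Variables (C : numClosedFieldType) (vT : vectType C).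
Variable B : {hermitian vT for false & Num.conj}.
Implicit Types (u v w x y : vT) (X Y S U W : {vspace vT}) (P N Q M F G : seq vT).

Definition splits U W :=
  [/\ (U + W)%VS = fullv, (U :&: W)%VS = 0%VS & (U <= orthov B W)%VS].

Lemma splits_sym U W : splits U W -> splits W U.
Proof.
by case=> sUW dUW oUW; split; rewrite 1?addvC 1?capvC // orthov_sym.
Qed.

Definition isotropic S := (S <= orthov B S)%VS.

Lemma isotropicP S : reflect {in S &, forall u v, B u v = 0} (isotropic S).
Proof. exact: orthovP. Qed.

Lemma lift_seq (f : 'End(vT)) S F : {subset F <= (f @: S)%VS} ->
  exists2 G, {subset G <= S} & map f G = F.
Proof.
elim: F => [|x F IH] sF; first by exists [::].
have [|G sG <-] := IH; first by move=> y yF; rewrite sF // inE yF orbT.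
have /memv_imgP[y yS ->] := sF x (mem_head _ _).
by exists (y :: G) => // z; rewrite inE => /orP[/eqP->//|/sG].
Qed.

Section Fixed.
Variables U W : {vspace vT}.
Hypothesis sUW : splits U W.
Local Notation p := (daddv_pi U W).
Local Notation q := (daddv_pi W U).

Lemma dpi_add v : p v + q v = v.
Proof.
by case: sUW => s d _; apply: daddv_pi_add => //; rewrite s memvf.
Qed.

Lemma dpi_id v : v \in U -> p v = v.
Proof. by case: sUW => _ d _; apply: daddv_pi_id. Qed.

Lemma dpi_0 v : v \in W -> p v = 0.
Proof.
have [_ d _] := splits_sym sUW.
move=> vW; have := dpi_add v; rewrite (daddv_pi_id d vW).
by move/(canRL (addrK _)); rewrite subrr.
Qed.

Lemma dpi_eq0 v : p v = 0 -> v \in W.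
Proof. by move=> pv0; rewrite -(dpi_add v) pv0 add0r memv_pi. Qed.

Lemma herm_pi_orth u v : B (p u) (q v) = 0.
Proof.
case: sUW => _ _ /orthovP; apply; exact: memv_pi.
Qed.

Lemma herm_pi u v : B u v = B (p u) (p v) + B (q u) (q v).
Proof.
rewrite -{1}(dpi_add u) -{1}(dpi_add v) !hermE herm_pi_orth.
by rewrite (herm0C (herm_pi_orth _ _)) addr0 add0r.
Qed.

Lemma herm_pil u v : u \in U -> B u v = B u (p v).
Proof.
move=> uU; rewrite -{1}(dpi_add v) hermDr -{2}(dpi_id uU).
by rewrite herm_pi_orth addr0.
Qed.

Lemma proj_img S : proj U W S = (p @: S)%VS.
Proof.
apply/vspaceP => v; rewrite memv_cap; apply/andP/memv_imgP.
  case=> /memv_addP[s sS [w wW def_v]] vU; exists s => //.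
  by rewrite -[LHS](dpi_id vU) def_v linearD /= (dpi_0 wW) addr0.
case=> s sS ->; rewrite memv_pi; split=> //.
rewrite -[p s](addrK (q s)) dpi_add memv_add // memvN.
exact: memv_pi.
Qed.

Lemma proj_subl S : (proj U W S <= U)%VS. Proof. exact: capvSr. Qed.

Lemma pi_proj S s : s \in S -> p s \in proj U W S.
Proof. by rewrite proj_img; apply: memv_img. Qed.

Lemma dim_proj S : (\dim (S :&: W) + \dim (proj U W S))%N = \dim S.
Proof.
rewrite proj_img -(limg_ker_dim p S); congr (\dim (S :&: _) + _)%N.
apply/vspaceP => v; rewrite memv_ker; apply/idP/eqP; first exact: dpi_0.
exact: dpi_eq0.
Qed.

Lemma isotropic_pi S : isotropic S ->
  {in S &, forall u v, B (p u) (p v) = - B (q u) (q v)}.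
Proof.
move=> /isotropicP iS u v uS vS; have := iS u v uS vS.
by rewrite herm_pi => /eqP; rewrite addr_eq0 => /eqP.
Qed.

Lemma cap_radical S : isotropic S -> (S :&: U <= radical B (proj U W S))%VS.
Proof.
move=> iS; apply/subvP => v /memv_capP[vS vU]; apply/mem_radicalP; split.
  by rewrite -(dpi_id vU) pi_proj.
rewrite proj_img => _ /memv_imgP[s sS ->]; rewrite -herm_pil //.
exact: (isotropicP _ iS).
Qed.

(** The two projections of an isotropic subspace carry opposite forms, so lifting a frame from one
    and projecting to the other exchanges positive and negative vectors. *)
Lemma frame_lift S P N : isotropic S -> frame B P N -> {subset P ++ N <= proj U W S} ->
  exists P' N', [/\ {subset P' ++ N' <= S}, map p P' = P, map p N' = N &
     frame B (map q N') (map q P')].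
Proof.
rewrite proj_img => iS fPN sPN.
have [|P' sP' defP] := @lift_seq p S P.
  by move=> v vP; apply: sPN; rewrite mem_cat vP.
have [|N' sN' defN] := @lift_seq p S N.
  by move=> v vN; apply: sPN; rewrite mem_cat vN orbT.
have sPN' : {subset P' ++ N' <= S}.
  by move=> v; rewrite mem_cat => /orP[/sP'|/sN'].
exists P', N'; split=> //; apply: (@frame_map_anti _ _ _ p).
  by move=> u v /sPN' uS /sPN' vS; apply: (isotropic_pi iS).
by rewrite defP defN.
Qed.

End Fixed.

Lemma proj_index_le U W S : splits U W -> isotropic S ->
  (posindex B (proj U W S) <= negindex B (proj W U S))%N /\
  (negindex B (proj U W S) <= posindex B (proj W U S))%N.
Proof.
move=> sUW iS; have [P [N cPN]] := complete_ex B (proj U W S).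
have [-> ->] := complete_index cPN; case: cPN => fPN sPN _.
have [P' [N' [sS <- <- fq]]] := frame_lift sUW iS fPN sPN.
rewrite !size_map -(size_map (daddv_pi W U)) -(size_map (daddv_pi W U) N').
have [|? ?] := @frame_index _ _ B (proj W U S) _ _ fq.
  rewrite (proj_img (splits_sym sUW)) -map_cat => _ /mapP[s sF ->].
  by apply/memv_img/sS; rewrite mem_cat orbC -mem_cat.
by [].
Qed.

Lemma proj_index U W S : splits U W -> isotropic S ->
  posindex B (proj U W S) = negindex B (proj W U S) /\
  negindex B (proj U W S) = posindex B (proj W U S).
Proof.
move=> sUW iS; have [? ?] := proj_index_le sUW iS.
have [? ?] := proj_index_le (splits_sym sUW) iS.
by split; apply/eqP; rewrite eqn_leq; apply/andP.
Qed.

(** Meant for lists of vectors of opposite norms, orthogonal to each other: the sums are then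
    isotropic. *)
Definition addseq F G := [seq z.1 + z.2 | z <- zip F G].

Lemma addseq_map (f g : vT -> vT) (F : seq vT) :
  addseq (map f F) (map g F) = [seq f x + g x | x <- F].
Proof. by rewrite /addseq zip_map -map_comp. Qed.

Lemma map_addseq (h : 'End(vT)) F G : map h (addseq F G) = addseq (map h F) (map h G).
Proof.
rewrite /addseq -map_comp; elim: F G => [|x F IH] [|y G] //=.
by rewrite IH linearD.
Qed.

(** Complete frames of nondegenerate spaces are bases, so matching them defines a linear map; it
    preserves the form on [U] and on [W] because it does so on orthogonal bases. *)
Lemma complete_transport U W P N Q M P' N' Q' M' : splits U W ->
  complete B U P N -> complete B W Q M -> complete B U P' N' -> complete B W Q' M' ->
  radical B U = 0%VS -> radical B W = 0%VS ->
  size P = size P' -> size N = size N' -> size Q = size Q' -> size M = size M' ->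
  exists2 h : 'End(vT), inH B U W h &
    [/\ map h P = P', map h N = N', map h Q = Q' & map h M = M'].
Proof.
move=> sUW cU cW cU' cW' rU rW sP sN sQ sM.
have frP : free ((P ++ N) ++ (Q ++ M)).
  case: (sUW) (cU) (cW) => _ d _ [fU _ _] [fW _ _].
  rewrite cat_free (frame_free fU) (frame_free fW).
  rewrite (complete_span rU cU) (complete_span rW cW) /=.
  exact/directv_addP.
have [f] := linear_of_free ((P ++ N) ++ (Q ++ M)) ((P' ++ N') ++ (Q' ++ M')).
move=> /(_ frP); rewrite !size_cat sP sN sQ sM => /(_ erefl).
rewrite !map_cat => /eqP; rewrite !eqseq_cat ?size_cat ?size_map ?sP ?sN ?sQ ?sM //.
case/andP=> /andP[/eqP fP /eqP fN] /andP[/eqP fQ /eqP fM].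
have mapE F : map (linfun f) F = map f F by apply: eq_map => v; rewrite lfunE.
have isoP X (P1 N1 P2 N2 : seq vT) : complete B X P1 N1 -> complete B X P2 N2 ->
    radical B X = 0%VS -> map f P1 = P2 -> map f N1 = N2 ->
    isometry_of B X (linfun f).
  move=> c1 c2 rX fP1 fN1; split.
    rewrite -{1}(complete_span rX c1) limg_span mapE map_cat fP1 fN1.
    exact: (complete_span rX c2).
  rewrite -(complete_span rX c1).
  case: (c1) (c2) => [/and3P[oF1 p1 n1] _ _] [/and3P[oF2 p2 n2] _ _].
  apply: isometry_span => //; first by rewrite mapE map_cat fP1 fN1.
  move=> x; rewrite lfunE mem_cat /= => /orP[xP|xN].
    rewrite (eqP (allP p1 _ xP)); apply/eqP; apply: (allP p2).
    by rewrite -fP1 map_f.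
  rewrite (eqP (allP n1 _ xN)); apply/eqP; apply: (allP n2).
  by rewrite -fN1 map_f.
exists (linfun f); last by rewrite !mapE.
by split; [apply: isoP cU cU' _ _ _|apply: isoP cW cW' _ _ _].
Qed.

End Splitting.

(** * Witt's theorem *)

Section Normal.
Variables (C : numClosedFieldType) (vT : vectType C).
Variable B : {hermitian vT for false & Num.conj}.
Implicit Types (u v w x y : vT) (X Y S U W : {vspace vT}) (P N Q M F G E Z : seq vT).

Lemma frame_span_orth0 P N v : frame B P N -> v \in <<P ++ N>>%VS ->
  {in P ++ N, forall y, B v y = 0} -> v = 0.
Proof.
by move=> f; apply: oseq_span_orth0; [apply: frame_oseq|apply: frame_aniso].
Qed.

(** Since [X] is nondegenerate, the linear form equal to 1 at [z] and to 0 on [L] is the product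
    with a vector of [X]. *)
Lemma dual_vector X L z : radical B X = 0%VS -> free (z :: L) ->
  {subset z :: L <= X} ->
  exists x, [/\ x \in X, B z x = 1 & {in L, forall v, B v x = 0}].
Proof.
move=> rX frL sL; have [P [N cX]] := complete_ex B X.
have spX := complete_span rX cX; case: cX => fPN _ _.
have [f] := linear_of_free (z :: L) ((1 : C^o) :: [seq (0 : C^o) | v <- L]).
move=> /(_ frL); rewrite /= size_map => /(_ erefl) [fz fL].
have [x] := herm_repr f (frame_oseq fPN) (frame_aniso fPN).
rewrite spX => xX fx; exists x; split=> //.
  by rewrite fx ?fz // sL ?mem_head.
move=> v vL; rewrite fx; last by rewrite sL // inE vL orbT.
have := map_f f vL; rewrite fL => /mapP[_ _]; exact.
Qed.

(** Each [z] gets a partner [x], orthogonal to the rest of [Z] and to the frame; their hyperbolic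
    plane provides one vector of each sign, with sum [z]. Both join the frame before the induction
    goes on. *)
Lemma hyperbolic X P N Z : radical B X = 0%VS -> frame B P N -> {subset P ++ N <= X} ->
  free Z -> {subset Z <= X} -> {in Z &, forall y z, B y z = 0} ->
  {in Z & P ++ N, forall z y, B z y = 0} ->
  exists E F, [/\ size E = size Z, size F = size Z, frame B (E ++ P) (F ++ N),
    {subset (E ++ P) ++ F ++ N <= X} & <<addseq E F>>%VS = <<Z>>%VS].
Proof.
move=> rX; elim: Z P N => [|z Z IH] P N fPN sPN frZ sZ isoZ oZ.
  by exists [::], [::].
have frL : free (z :: (Z ++ (P ++ N))).
  rewrite -cat_cons cat_free frZ (frame_free fPN) /=; apply/directv_addP.
  apply/eqP; rewrite -subv0; apply/subvP => v /memv_capP[vZ vF]; rewrite memv0.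
  apply/eqP/(frame_span_orth0 fPN vF) => y yF; apply: herm0C.
  by apply: orth_span vZ => w wZ; apply/herm0C/oZ.
have sL : {subset z :: (Z ++ (P ++ N)) <= X}.
  by move=> y; rewrite -cat_cons mem_cat => /orP[/sZ|/sPN].
have [x0 [x0X zx0 ox0]] := dual_vector rX frL sL.
have zX : z \in X by apply: sZ; rewrite mem_head.
have zz : B z z = 0 by apply: isoZ; rewrite mem_head.
have x0z : B x0 z = 1 by rewrite herm_sym zx0 rmorph1.
(* As [B z x0 = 1] and [z] is isotropic, adding [s *: z] changes the norm of [x0] by 2s; this [s]
   makes [x] isotropic and keeps its product with [z]. *)
pose s := - (B x0 x0 / 2); pose x := x0 + s *: z.
have s_real : s^* = s.
  by apply: conj_Creal; rewrite rpredN rpredM ?herm_real // rpredV realn.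
have xX : x \in X by rewrite memvD // memvZ.
have zx : B z x = 1 by rewrite /x hermDr hermZr zz zx0 mulr0 addr0.
have xz : B x z = 1 by rewrite herm_sym zx rmorph1.
have xx : B x x = 0.
  by rewrite /x !hermE zz x0z zx0 s_real /s; field.
have ox y : y \in Z ++ (P ++ N) -> B y z = 0 -> B y x = 0.
  by move=> yL yz; rewrite hermDr hermZr yz mulr0 addr0 ox0.
clearbody x.
have oz y : y \in Z ++ (P ++ N) -> B y z = 0.
  rewrite mem_cat => /orP[yZ|yF]; first by apply: isoZ; rewrite inE ?eqxx ?yZ ?orbT.
  by apply/herm0C/oZ; rewrite ?mem_head.
(* The coefficient 1/2 gives norms 1 and -1, and [e + f = z]. *)
pose e := 2^-1 *: z + x; pose f := 2^-1 *: z - x.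
have half_real : (2^-1 : C)^* = 2^-1 by rewrite conj_Creal // rpredV realn.
have ee : B e e = 1 by rewrite /e !hermE zz zx xz xx half_real; field.
have ff : B f f = - 1 by rewrite /f !hermE zz zx xz xx half_real; field.
have ef : B e f = 0 by rewrite /e /f !hermE zz zx xz xx half_real; field.
have oef y : y \in Z ++ (P ++ N) -> B y e = 0 /\ B y f = 0.
  by move=> yL; rewrite /e /f !hermE (ox _ yL) (oz _ yL) // !mulr0 subr0 addr0.
have frame_ef : frame B (e :: P) (f :: N).
  rewrite -(cat1s e) -(cat1s f) frame_cat fPN andTb; apply/andP; split.
    by rewrite /frame /oseq /= ee ff ef !eqxx.
  apply/allrelP => y v; rewrite !inE => /orP[]/eqP-> vF; apply/eqP/herm0C.
    by apply: (oef v _).1; rewrite mem_cat vF orbT.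
  by apply: (oef v _).2; rewrite mem_cat vF orbT.
have eX : e \in X by rewrite memvD // memvZ.
have fX : f \in X by rewrite memvB // memvZ.
have [|||||E [F [sE sF fEF sEF spEF]]] := IH _ _ frame_ef.
- move=> y; rewrite mem_cat !inE -orbA => /or4P[/eqP->//|yP|/eqP->//|yN];
  by rewrite sPN // mem_cat ?yP ?yN ?orbT.
- by move: frZ; rewrite free_cons => /andP[].
- by move=> y yZ; rewrite sZ // inE yZ orbT.
- by move=> y v yZ vZ; apply: isoZ; rewrite inE ?yZ ?vZ orbT.
- move=> y v yZ; have [|ye yf] := oef y; first by rewrite mem_cat yZ.
  rewrite mem_cat !inE -orbA => /or4P[/eqP->//|vP|/eqP->//|vN];
  by apply: oZ; rewrite ?inE ?yZ ?orbT // mem_cat ?vP ?vN ?orbT.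
exists (rcons E e), (rcons F f); rewrite !size_rcons sE sF !cat_rcons; split=> //.
have -> : addseq (rcons E e) (rcons F f) = rcons (addseq E F) z.
  rewrite /addseq zip_rcons ?sE ?sF // map_rcons /=; congr (rcons _ _).
  rewrite /e /f addrACA subrr addr0 -scalerDl (_ : _ + _ = 1) ?scale1r //.
  by field.
by rewrite -cats1 span_cat spEF span_seq1 span_cons addvC.
Qed.

(* That is, [r_Y(S) = 0] and [a(S) = 0] when [Y] is one of [U] and [W]. *)
Definition tame X Y S := [/\ isotropic B S, (S :&: Y = 0)%VS &
  \dim (radical B (proj X Y S)) = \dim (S :&: X)].

(** Tameness identifies the radical of the projection with [S :&: X], so [S] is spanned by lifts of
    a frame of the projection and by [S :&: X]. A lift is the sum of its components in [X] and [Y],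
    of opposite norms, and [hyperbolic] writes [S :&: X] with pairs inside [X]. The lists [P2],
    [N2], [Q2], [M2] complete the bases. *)
Lemma normal_form X Y S : splits B X Y -> radical B X = 0%VS -> radical B Y = 0%VS ->
  tame X Y S ->
  exists P N E F Q M P2 N2 Q2 M2,
    [/\ complete B X (P ++ E ++ P2) (N ++ F ++ N2), complete B Y (Q ++ Q2) (M ++ M2),
        [/\ size P = posindex B (proj X Y S), size M = posindex B (proj X Y S),
            size N = negindex B (proj X Y S) & size Q = negindex B (proj X Y S)],
        size E = \dim (S :&: X) /\ size F = \dim (S :&: X) &
        S = <<addseq P M ++ addseq N Q ++ addseq E F>>%VS].
Proof.
move=> sXY rX rY [iS SY radS].
have [P [N cPN]] := complete_ex B (proj X Y S).
have [posP negN] := complete_index cPN.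
have [spPN _ _] := complete_decomp cPN.
have rad_eq : radical B (proj X Y S) = (S :&: X)%VS.
  by apply/eqP; rewrite eq_sym eqEdim (cap_radical sXY iS) radS leqnn.
rewrite rad_eq in spPN; case: (cPN) => fPN sPN _.
have [P' [N' [sPN' defP defN fQM]]] := frame_lift sXY iS fPN sPN.
pose Z : seq vT := vbasis (S :&: X).
have spZ : <<Z>>%VS = (S :&: X)%VS by apply/span_basis/vbasisP.
have frZ : free Z by apply/basis_free/vbasisP.
have szZ : size Z = \dim (S :&: X) by rewrite size_tuple.
have sZ : {subset Z <= (S :&: X)%VS} by move=> z; apply: vbasis_mem.
have [||||E [F [szE szF fEF sEF spEF]]] := hyperbolic rX fPN _ frZ.
- by move=> y /sPN; apply/subvP/proj_subl.
- by move=> z /sZ /memv_capP[].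
- move=> y z /sZ /memv_capP[yS _] /sZ /memv_capP[zS _].
  exact: (isotropicP _ _ iS).
- move=> z y /sZ zS /sPN yS; move: zS; rewrite -rad_eq => /mem_radicalP[_]; exact.
have [P2 [N2 cX]] := frame_ext fEF sEF.
have sQM : {subset map (daddv_pi Y X) N' ++ map (daddv_pi Y X) P' <= Y}.
  by rewrite -map_cat => _ /mapP[y _ ->]; apply: memv_pi.
have [Q2 [M2 cY]] := frame_ext fQM sQM.
have swap (G H K : seq vT) : perm_eq ((G ++ H) ++ K) (H ++ G ++ K).
  by rewrite catA perm_cat2r perm_catC.
exists P, N, E, F, (map (daddv_pi Y X) N'), (map (daddv_pi Y X) P'), P2, N2, Q2, M2.
split=> //.
- case: cX => fX sX rX'.
  have mem_eq : (P ++ E ++ P2) ++ (N ++ F ++ N2) =i ((E ++ P) ++ P2) ++ (F ++ N) ++ N2.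
    by move=> y; apply/perm_mem; rewrite perm_sym perm_cat.
  split; first exact: frame_perm fX.
    by move=> y; rewrite mem_eq; apply: sX.
  by move=> v vX vo; apply: rX' => // y; rewrite -mem_eq; apply: vo.
- by rewrite !size_map posP negN -defP -defN !size_map.
- by rewrite -szZ.
have defS (G : seq vT) : G = addseq (map (daddv_pi X Y) G) (map (daddv_pi Y X) G).
  rewrite addseq_map -[LHS]map_id; apply: eq_map => v.
  by rewrite (dpi_add sXY).
rewrite -{1}defP -{1}defN -!defS !span_cat spEF -!span_cat.
apply/eqP; rewrite eq_sym eqEdim; apply/andP; split.
  apply/span_subvP => v; rewrite catA mem_cat => /orP[/sPN'//|/sZ].
  by case/memv_capP.
(* As [S :&: Y] is 0, the projection to [X] is injective on [S], and dimensions can be compared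
   after projecting. *)
rewrite -(dim_proj sXY S) SY dimv0 add0n.
have -> : proj X Y S = (daddv_pi X Y @: <<P' ++ N' ++ Z>>)%VS.
  rewrite limg_span !map_cat defP defN -spPN catA [RHS]span_cat -spZ; congr (_ + span _)%VS.
  rewrite -[LHS]map_id; apply/eq_in_map => z /sZ /memv_capP[_ zX].
  by rewrite (dpi_id sXY).
by rewrite -(limg_ker_dim (daddv_pi X Y) <<P' ++ N' ++ Z>>) leq_addl.
Qed.

(** The two normal forms follow the same pattern: the invariants fix the lengths of the lists
    spanning the subspaces, and the indices of [X] and [Y] fix the total lengths, so the bases can
    be matched. *)
Lemma tame_transitive X Y S T : splits B X Y -> radical B X = 0%VS -> radical B Y = 0%VS ->
  tame X Y S -> tame X Y T ->
  posindex B (proj X Y S) = posindex B (proj X Y T) ->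
  negindex B (proj X Y S) = negindex B (proj X Y T) ->
  \dim (S :&: X) = \dim (T :&: X) ->
  exists2 h : 'End(vT), inH B X Y h & (h @: S)%VS = T.
Proof.
move=> sXY rX rY tS tT ePos eNeg eDim.
have [P [N [E [F [Q [M [P2 [N2 [Q2 [M2 []]]]]]]]]]] := normal_form sXY rX rY tS.
move=> cX cY [sP sM sN sQ] [sE sF] ->.
have [P' [N' [E' [F' [Q' [M' [P2' [N2' [Q2' [M2' []]]]]]]]]]] := normal_form sXY rX rY tT.
move=> cX' cY' [sP' sM' sN' sQ'] [sE' sF'] ->.
have [pX nX] := complete_index cX; have [pX' nX'] := complete_index cX'.
have [pY nY] := complete_index cY; have [pY' nY'] := complete_index cY'.
have [||||h hH [mP mN mQ mM]] := complete_transport sXY cX cY cX' cY' rX rY.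
- by rewrite -pX -pX'.
- by rewrite -nX -nX'.
- by rewrite -pY -pY'.
- by rewrite -nY -nY'.
have split_cat (G H K L : seq vT) : size G = size K -> G ++ H = K ++ L -> G = K /\ H = L.
  by move=> sz /eqP; rewrite eqseq_cat // => /andP[/eqP-> /eqP->].
move: mP mN mQ mM; rewrite !map_cat.
have [eP eN] : size P = size P' /\ size N = size N' by rewrite sP sP' sN sN'.
have [eQ eM] : size Q = size Q' /\ size M = size M' by rewrite sQ sQ' sM sM'.
have [eE eF] : size E = size E' /\ size F = size F' by rewrite sE sE' sF sF'.
move=> /split_cat; rewrite size_map => /(_ eP)[mP] /split_cat.
rewrite size_map => /(_ eE)[mE _].
move=> /split_cat; rewrite size_map => /(_ eN)[mN] /split_cat.
rewrite size_map => /(_ eF)[mF _].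
move=> /split_cat; rewrite size_map => /(_ eQ)[mQ _].
move=> /split_cat; rewrite size_map => /(_ eM)[mM _].
exists h => //; rewrite limg_span !map_cat !map_addseq.
by rewrite mP mE mN mF mQ mM.
Qed.

Lemma inH_lker0 U W h : splits B U W -> inH B U W h -> lker h == 0%VS.
Proof.
case=> sUW _ _ [[hU _] [hW _]].
have img : limg h = fullv by rewrite -sUW limgD hU hW.
have := limg_ker_dim h fullv; rewrite img capfv => /eqP.
by rewrite -{2}[\dim fullv]add0n eqn_add2r dimv_eq0.
Qed.

Lemma inH_herm U W h : splits B U W -> inH B U W h -> forall u v, B (h u) (h v) = B u v.
Proof.
move=> sUW [[hU iU] [hW iW]] u v; case: (sUW) => _ _ /orthovP oUW.
rewrite -{1}(dpi_add sUW u) -{1}(dpi_add sUW v) !linearD /= (herm_pi sUW u v).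
rewrite !hermE (iU _ _ (memv_pi U W u) (memv_pi U W v)).
rewrite (iW _ _ (memv_pi W U u) (memv_pi W U v)).
have mU w : h (daddv_pi U W w) \in U by have := memv_img h (memv_pi U W w); rewrite hU.
have mW w : h (daddv_pi W U w) \in W by have := memv_img h (memv_pi W U w); rewrite hW.
by rewrite (oUW _ _ (mU _) (mW _)) (herm0C (oUW _ _ (mU _) (mW _))) addr0 add0r.
Qed.

Lemma inH_proj U W h S : splits B U W -> inH B U W h ->
  proj U W (h @: S) = (h @: proj U W S)%VS.
Proof.
move=> sUW hH; have k0 := inH_lker0 sUW hH; case: hH => [[hU _] [hW _]].
by rewrite /Defs.proj lker0_img_cap // limgD hU hW.
Qed.

Lemma img_index (h : 'End(vT)) X : (forall u v, B (h u) (h v) = B u v) ->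
  posindex B (h @: X) = posindex B X /\ negindex B (h @: X) = negindex B X.
Proof.
move=> hB; have [P [N cX]] := complete_ex B X.
have [-> ->] := complete_index cX; case: cX => fPN sPN rX.
have cH : complete B (h @: X) (map h P) (map h N).
  split; first by apply: frame_map.
    by rewrite -map_cat => _ /mapP[y /sPN yX ->]; apply: memv_img.
  move=> _ /memv_imgP[v vX ->] vo; have /mem_radicalP[_ vr] : v \in radical B X.
    by apply: rX => // y yF; rewrite -hB vo // -map_cat map_f.
  apply/mem_radicalP; split; first exact: memv_img.
  by move=> _ /memv_imgP[u uX ->]; rewrite hB vr.
by have [-> ->] := complete_index cH; rewrite !size_map.
Qed.

Lemma inH_Gr U W h S r : splits B U W -> inH B U W h -> Gr B r S -> Gr B r (h @: S)%VS.
Proof.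
move=> sUW hH [dS /isotropicP iS]; split.
  by rewrite limg_dim_eq // (eqP (inH_lker0 sUW hH)) capv0.
apply/isotropicP => _ _ /memv_imgP[u uS ->] /memv_imgP[v vS ->].
by rewrite (inH_herm sUW hH) iS.
Qed.

End Normal.

(** * Orbits of maximal index *)

Section Orbits.
Variables (C : numClosedFieldType) (vT : vectType C).
Variable B : {hermitian vT for false & Num.conj}.
Implicit Types (u v w x y : vT) (X Y S T U W : {vspace vT}) (P N Q M F G E Z : seq vT).

(* In the open orbits both indices of the projection are as large as possible,
   so that lower bounds characterize them. *)
Definition Gr_index U W r b c : set {vspace vT} :=
  [set S | [/\ Gr B r S, b <= posindex B (proj U W S) &
                         c <= negindex B (proj U W S)]%N].

Lemma index_sum_le U W S : splits B U W ->
  (posindex B (proj U W S) + negindex B (proj U W S) <= \dim S)%N.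
Proof.
move=> sUW; have := dim_proj sUW S; have := dim_index B (proj U W S); lia.
Qed.

(** The dimension of [S] is the sum of that of [S :&: W], the two indices and the dimension of the
    radical. If the indices exhaust it, the other terms vanish, and so does [S :&: U], contained in
    the radical. *)
Lemma tame_of_dim U W S : splits B U W -> isotropic B S ->
  (posindex B (proj U W S) + negindex B (proj U W S) = \dim S)%N ->
  [/\ tame B U W S, \dim (S :&: U) = 0%N, \dim (S :&: W) = 0%N &
      \dim (radical B (proj U W S)) = 0%N].
Proof.
move=> sUW iS full; have dS := dim_proj sUW S; have dP := dim_index B (proj U W S).
have := dimvS (cap_radical sUW iS) => dSU.
have [dW0 dU0 dr0] : [/\ \dim (S :&: W) = 0%N, \dim (S :&: U) = 0%N &
    \dim (radical B (proj U W S)) = 0%N] by split; lia.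
by split=> //; split; rewrite ?dr0 ?dU0 //; apply/eqP; rewrite -dimv_eq0 dW0.
Qed.

(** The projection to [Y] has the same indices, exchanged, so it fills [Y] and is nondegenerate;
    [S :&: Y], contained in its radical, is 0. Counting dimensions through each projection gives
    [\dim S - \dim Y] both for [S :&: X] and for the radical of the projection to [X]. *)
Lemma tame_of_codim X Y S : splits B X Y -> isotropic B S ->
  (posindex B (proj X Y S) + negindex B (proj X Y S) = \dim Y)%N ->
  [/\ tame B X Y S, \dim (S :&: X) = (\dim S - \dim Y)%N,
      \dim (S :&: Y) = 0%N & \dim (radical B (proj Y X S)) = 0%N].
Proof.
move=> sXY iS full; have sYX := splits_sym sXY.
have dX := dim_proj sXY S; have dY := dim_proj sYX S.
have rX := dim_index B (proj X Y S); have rY := dim_index B (proj Y X S).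
have [eP eN] := proj_index sXY iS.
have leY := dimvS (proj_subl Y X S); have := dimvS (cap_radical sYX iS) => leSY.
have [dSY dSX [dr0 dr]] : [/\ \dim (S :&: Y) = 0%N,
    \dim (S :&: X) = (\dim S - \dim Y)%N,
    \dim (radical B (proj Y X S)) = 0%N &
    \dim (radical B (proj X Y S)) = \dim (S :&: X)] by split; lia.
by split=> //; split=> //; apply/eqP; rewrite -dimv_eq0 dSY.
Qed.

Lemma Gr_index_inH U W r b c h S : splits B U W -> inH B U W h ->
  Gr_index U W r b c S -> Gr_index U W r b c (h @: S)%VS.
Proof.
move=> sUW hH [SGr Sb Sc].
have [eb ec] := img_index (proj U W S) (inH_herm sUW hH).
by split; [exact: (inH_Gr sUW hH)|rewrite (inH_proj _ sUW hH) eb|rewrite (inH_proj _ sUW hH) ec].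
Qed.

Lemma inHC U W h : inH B U W h -> inH B W U h.
Proof. by case. Qed.

Lemma Horbit_refl U W S : Horbit B U W S S.
Proof.
exists \1%VF; last by rewrite lim1g.
by split; split=> [|u v _ _]; rewrite ?lim1g ?id_lfunE.
Qed.

(** Here [X] is the summand that the subspaces may meet, [U] or [W] depending on the case; the
    condition defining H is symmetric in the two. *)
Lemma Gr_index_Horbit U W X Y r b c b' c' k S :
  splits B U W -> radical B U = 0%VS -> radical B W = 0%VS ->
  (X = U /\ Y = W) \/ (X = W /\ Y = U) ->
  (forall T, Gr_index U W r b c T ->
     [/\ tame B X Y T, posindex B (proj X Y T) = b', negindex B (proj X Y T) = c' &
         \dim (T :&: X) = k]) ->
  Gr_index U W r b c S -> Horbit B U W S = Gr_index U W r b c.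
Proof.
move=> sUW rU rW XY inv SG; apply/seteqP; split=> [T [h hH <-]|T TG].
  exact: Gr_index_inH.
have [tS pS nS dS] := inv S SG; have [tT pT nT dT] := inv T TG.
have sXY : splits B X Y by case: XY => -[-> ->] //; apply: splits_sym.
have [||h hH hS] := tame_transitive sXY _ _ tS tT (etrans pS (esym pT))
    (etrans nS (esym nT)) (etrans dS (esym dT)).
- by case: XY => -[-> _].
- by case: XY => -[_ ->].
by exists h => //; case: XY hH => -[-> ->] // /inHC.
Qed.

Lemma mem_addseq P N v : v \in addseq P N ->
  exists x y, [/\ x \in P, y \in N & v = x + y].
Proof.
elim: P N => [|x P IH] [|y N] //=; rewrite inE => /orP[/eqP->|/IH].
  by exists x, y; rewrite !mem_head.
by move=> [x' [y' [xP yN ->]]]; exists x', y'; rewrite !inE xP yN !orbT.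
Qed.

Lemma isotropic_addseq P N : frame B P N -> size P = size N ->
  isotropic B <<addseq P N>>%VS /\ \dim <<addseq P N>> = size P.
Proof.
move=> fPN sPN.
have [iso fr] : {in addseq P N &, forall u v, B u v = 0} /\ free (addseq P N).
  elim: P N fPN sPN => [|x P IH] [|y N] //; first by rewrite nil_free.
  rewrite -(cat1s x) -(cat1s y) frame_cat => /and3P[f1 fPN orth1] [sPN].
  have {IH} [iso fr] := IH N fPN sPN.
  have ox v : v \in addseq P N -> B x v = 0 /\ B y v = 0.
    case/mem_addseq=> x' [y' [xP yN ->]].
    have o1 z w : z \in [:: x; y] -> w \in P ++ N -> B z w = 0.
      by move=> zz ww; apply/eqP/(allrelP orth1).
    have [xF yF] : x' \in P ++ N /\ y' \in P ++ N by rewrite !mem_cat xP yN orbT.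
    by rewrite !hermDr !o1 ?addr0 // ?mem_head // inE mem_seq1 eqxx orbT.
  case/and3P: f1; rewrite /oseq /= !andbT => /eqP xy /eqP xx /eqP yy.
  split.
    have oxy v : v \in addseq P N -> B (x + y) v = 0.
      by move/ox=> [xv yv]; rewrite hermDl xv yv addr0.
    move=> u v; rewrite /= !inE => /orP[/eqP->|uL] /orP[/eqP->|vL].
    - by rewrite !hermE xx yy xy (herm0C xy) addr0 add0r subrr.
    - exact: oxy.
    - exact/herm0C/oxy.
    - exact: iso.
  rewrite /= free_cons fr andbT; apply/negP => xyL.
  (* Independence: [x] has product 1 with [x + y] and 0 with the other sums. *)
  have : B x (x + y) = 0 by apply: orth_span xyL => v /ox[].
  by rewrite hermDr xx xy addr0 => /eqP; rewrite oner_eq0.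
split; last by rewrite (eqnP fr) size_map size_zip sPN minnn.
apply/isotropicP => u v uL vL; apply/herm0C.
apply: orth_span uL => z zL; apply/herm0C; apply: orth_span vL => t tL.
exact: iso.
Qed.

Lemma addseq_cat F G F' G' : size F = size F' ->
  addseq (F ++ G) (F' ++ G') = addseq F F' ++ addseq G G'.
Proof. by move=> sF; rewrite /addseq zip_cat // map_cat. Qed.

Section Signature.
Variables (p q p1 q1 r : nat) (U W : {vspace vT}).
Hypothesis sUW : splits B U W.

Lemma small_index b c T : (b + c = r)%N -> Gr_index U W r b c T ->
  [/\ tame B U W T, posindex B (proj U W T) = b, negindex B (proj U W T) = c,
      \dim (T :&: U) = 0%N & \dim (T :&: W) = 0%N].
Proof.
move=> bc [[dT iT] bT cT]; have le := index_sum_le T sUW.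
have [|tT dU dW _] := tame_of_dim sUW iT; first by rewrite dT in le *; lia.
by split=> //; rewrite dT in le; lia.
Qed.

Lemma Orb_small b c : (b + c = r)%N -> Orb B U W r 0 0 0 b c = Gr_index U W r b c.
Proof.
move=> bc; apply/seteqP; split=> T.
  by case=> TGr [_ _ _ bT cT]; split=> //; rewrite -?bT -?cT.
move=> TG; have [[iT _ dr] pT nT dU dW] := small_index bc TG; case: TG => TGr _ _.
by split=> //; split=> //; rewrite /aS dr subnn.
Qed.

Hypothesis sigU : has_signature B U p1 q1.
Hypothesis sigW : has_signature B W (p - p1) (q - q1).
Let mU := minn p1 (q - q1).
Let mW := minn q1 (p - p1).
Let rU := signature_radical sigU.
Let rW := signature_radical sigW.

Lemma Horbit_small b c S : (b + c = r)%N -> Gr_index U W r b c S ->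
  Horbit B U W S = Gr_index U W r b c.
Proof.
move=> bc; apply: (@Gr_index_Horbit _ _ U W _ _ _ b c 0) => //; first by left.
by move=> T /(small_index bc)[].
Qed.

Lemma index_bounds S : isotropic B S ->
  (posindex B (proj U W S) <= mU)%N /\ (negindex B (proj U W S) <= mW)%N.
Proof.
move=> iS; have [eP eN] := proj_index sUW iS.
have [[_ pU nU] [_ pW nW]] := (sigU, sigW).
have ? := posindexS B (proj_subl U W S); have ? := negindexS B (proj_subl U W S).
have ? := posindexS B (proj_subl W U S); have ? := negindexS B (proj_subl W U S).
rewrite /mU /mW; lia.
Qed.

Hypothesis lep : (p1 <= p)%N.
Hypothesis leq1 : (q1 <= q)%N.
Hypothesis ler : (r <= minn p q)%N.

(** For [r = mU + mW] both intersections vanish and [T] is tame for either order of the summands, so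
    both branches hold. For larger [r], still at most [minn p q], the smaller summand has dimension
    [mU + mW] and serves as [Y] in [tame_of_codim]. *)
Lemma large_index T : (mU + mW <= r)%N -> Gr_index U W r mU mW T ->
  [/\ posindex B (proj U W T) = mU, negindex B (proj U W T) = mW &
    if (\dim W < \dim U)%N then
      [/\ tame B U W T, \dim (T :&: U) = (r - mU - mW)%N, \dim (T :&: W) = 0%N &
          aS B U W T = 0%N]
    else
      [/\ tame B W U T, \dim (T :&: W) = (r - mU - mW)%N, \dim (T :&: U) = 0%N &
          aS B U W T = 0%N]].
Proof.
move=> ler' TG; case: (TG) => -[dT iT] bT cT.
have [leb lec] := index_bounds iT.
have [eb ec] : posindex B (proj U W T) = mU /\ negindex B (proj U W T) = mW by lia.
split=> //; have sWU := splits_sym sUW; have [eP eN] := proj_index sUW iT.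
have [[dU _ _] [dW _ _]] := (sigU, sigW).
have [er|ner] := eqVneq r (mU + mW)%N.
  have [|tT dTU dTW dr] := tame_of_dim sUW iT; first by rewrite dT; lia.
  have [|tT' dTW' dTU' dr'] := tame_of_dim sWU iT; first by rewrite dT; lia.
  by case: ifP => _; split=> //; rewrite ?dTU ?dTW ?/aS ?dr ?dTU //; lia.
case: ifP => dims.
  have dimW : \dim W = (mU + mW)%N by move: ner dims; rewrite /mU /mW in ler' *; lia.
  have [|tT dTU dTW dr] := tame_of_codim sUW iT; first by lia.
  split=> //; first by rewrite dTU dT; lia.
  by rewrite /aS; case: tT => _ _ ->; rewrite subnn.
have dimU : \dim U = (mU + mW)%N by move: ner dims; rewrite /mU /mW in ler' *; lia.
have [|tT dTW dTU dr] := tame_of_codim sWU iT; first by lia.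
split=> //; first by rewrite dTW dT; lia.
by rewrite /aS dr.
Qed.

Lemma Orb_large : (mU + mW <= r)%N ->
  (if (\dim W < \dim U)%N then Orb B U W r (r - mU - mW) 0 0 mU mW
   else Orb B U W r 0 (r - mU - mW) 0 mU mW) = Gr_index U W r mU mW.
Proof.
move=> ler'; apply/seteqP; split=> T.
  by case: ifP => _ [TGr [_ _ _ bT cT]]; split=> //; rewrite -?bT -?cT.
move=> TG; have [pT nT] := large_index ler' TG; case: TG => TGr _ _.
by case: ifP => _ [tT dT dT' aT]; split.
Qed.

Lemma Horbit_large S : (mU + mW <= r)%N -> Gr_index U W r mU mW S ->
  Horbit B U W S = Gr_index U W r mU mW.
Proof.
move=> ler' SG; case dims: (\dim W < \dim U)%N.
  apply: (@Gr_index_Horbit _ _ U W _ _ _ mU mW (r - mU - mW)%N) => //; first by left.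
  by move=> T /(large_index ler'); rewrite dims => -[-> -> []].
apply: (@Gr_index_Horbit _ _ W U _ _ _ mW mU (r - mU - mW)%N) => //; first by right.
move=> T TG; have := large_index ler' TG; rewrite dims => -[eb ec [tT dT _ _]].
by case: TG => -[_ iT] _ _; have [<- <-] := proj_index sUW iT.
Qed.

Lemma Gr_index_nonempty b c : (b <= mU)%N -> (c <= mW)%N -> (b + c <= r)%N ->
  exists S, Gr_index U W r b c S.
Proof.
move=> leb lec lebc.
have [P [N cU]] := complete_ex B U; have [Q [M cW]] := complete_ex B W.
have [sP sN] := complete_index cU; have [sQ sM] := complete_index cW.
case: sigU sigW => dU pU nU [dW pW nW].
rewrite pU nU in sP sN; rewrite pW nW in sQ sM.
case: cU cW => fU inU _ [fW inW _].
(* Each pair of a vector of [F] and a vector of [G] gives an isotropic vector: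
   the first [b] pairs have their positive vector in [U], the next [c] pairs
   their negative one, and the other pairs are arbitrary. *)
pose F := (take b P ++ take c Q) ++ (drop b P ++ drop c Q).
pose G := (take b M ++ take c N) ++ (drop b M ++ drop c N).
have lebs : [/\ b <= p1, b <= q - q1, c <= q1 & c <= p - p1]%N.
  by move: leb lec; rewrite /mU /mW => ? ?; split; lia.
case: lebs => b1 b2 c1 c2.
have fFG : frame B F G.
  apply: (@frame_perm _ _ _ (P ++ Q) (N ++ M)).
  - by rewrite -{1}(cat_take_drop b P) -{1}(cat_take_drop c Q) perm_catACA.
  - rewrite perm_catC -{1}(cat_take_drop b M) -{1}(cat_take_drop c N).
    by rewrite perm_catACA.
  rewrite frame_cat fU fW; apply/allrelP => u v /inU uU /inW vW.
  by case: sUW => _ _ /orthovP o; apply/eqP/o.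
have tb : size (take b P) = b by rewrite size_takel //; lia.
have tc : size (take c Q) = c by rewrite size_takel //; lia.
have tb' : size (take b M) = b by rewrite size_takel //; lia.
have tc' : size (take c N) = c by rewrite size_takel //; lia.
(* With lengths p and q, the bound [r <= minn p q] ensures that there are [r] pairs to take, and
   [b + c <= r] that the prescribed ones are among them. *)
have szF : size F = p by rewrite !size_cat tb tc !size_drop; lia.
have szG : size G = q by rewrite !size_cat tb' tc' !size_drop; lia.
pose S := <<addseq (take r F) (take r G)>>%VS.
have [||iS dS] := @isotropic_addseq (take r F) (take r G).
- by apply: frame_sub fFG; apply: take_subseq.
- by rewrite !size_takel ?szF ?szG; lia.
have SGr : Gr B r S by split=> //; rewrite dS size_takel ?szF; lia.
have indexes : (b <= posindex B (proj U W S))%N /\ (c <= negindex B (proj U W S))%N.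
  have fr : frame B (take b P) (take c N) by apply: frame_sub fU; apply: take_subseq.
  rewrite -{1}tb -{1}tc'; apply: (frame_index fr) => v vF.
  have [w wW ws] : exists2 w, w \in W & v + w \in S.
    have mem (K L K' L' : seq vT) : size K = size L -> (size K <= r)%N ->
        {subset addseq K L <= addseq (take r (K ++ K')) (take r (L ++ L'))}.
      move=> sKL le z zKL; rewrite !take_cat -!sKL ltnNge le /= addseq_cat //.
      by rewrite mem_cat zKL.
    have subS : {subset addseq (take b P ++ take c Q) (take b M ++ take c N) <= S}.
      move=> z zL; apply/memv_span/mem => //; rewrite !size_cat; lia.
    rewrite addseq_cat ?tb // in subS.
    have ex (K L : seq vT) z : size K = size L -> z \in K ->
        exists2 y, y \in L & z + y \in addseq K L.
      elim: K L => [|x K IH] [|y L] //= [sKL]; rewrite inE => /orP[/eqP->|zK].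
        by exists y; rewrite ?mem_head.
      have [y' yL yK] := IH L sKL zK.
      by exists y'; rewrite inE ?yL ?yK orbT.
    move: vF; rewrite mem_cat => /orP[vP|vN].
      have [||y yM yS] := ex (take b P) (take b M) v; rewrite ?tb //.
      exists y; first by apply: inW; rewrite mem_cat (mem_take yM) orbT.
      by apply: subS; rewrite mem_cat yS.
    have [||y yQ yS] := ex (take c N) (take c Q) v; rewrite ?tc' //.
    exists y; first by apply: inW; rewrite mem_cat (mem_take yQ).
    apply: subS; rewrite mem_cat; apply/orP; right.
    (* These pairs were listed with the vector of [W] first. *)
    suff -> : addseq (take c Q) (take c N) = addseq (take c N) (take c Q) by [].
    elim: (take c N) (take c Q) => [|x K IH] [|z L] //=.
    by rewrite /addseq /= addrC -/(addseq _ _) IH.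
  have vU : v \in U.
    apply: inU; move: vF; rewrite !mem_cat => /orP[/mem_take->//|/mem_take->].
    by rewrite orbT.
  have -> : v = daddv_pi U W (v + w).
    by rewrite linearD /= (dpi_id sUW vU) (dpi_0 sUW wW) addr0.
  exact: (pi_proj sUW).
by exists S; case: indexes.
Qed.

End Signature.
End Orbits.

(** * Transvections *)

Section Transvections.
Variables (C : numClosedFieldType) (vT : vectType C).
Variable B : {hermitian vT for false & Num.conj}.
Implicit Types (u v w x y e : vT) (X Y S U W : {vspace vT}) (P N Q M F : seq vT).

(** For isotropic [e] and real [t] this is an isometry: the factor ['i] makes the two cross terms
    cancel. *)
Definition transv e (t : C) v : vT := v + (t * 'i * B v e) *: e.

Fact transv_is_linear e t : linear (transv e t).
Proof.
move=> a u v; rewrite /transv hermDl hermZl scalerDr addrACA scalerA.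
by congr (_ + _); rewrite -scalerDl; congr (_ *: _); ring.
Qed.

HB.instance Definition _ e t :=
  GRing.isLinear.Build C vT vT *:%R (transv e t) (transv_is_linear e t).

Lemma transv_herm e t u v : B e e = 0 -> t \is Num.real ->
  B (transv e t u) (transv e t v) = B u v.
Proof.
move=> ee /conj_Creal tr; rewrite /transv !hermE ee !rmorphM /= tr conjCi -herm_sym.
by ring.
Qed.

Lemma transv_id e t v : B v e = 0 -> transv e t v = v.
Proof. by move=> ve; rewrite /transv ve mulr0 scale0r addr0. Qed.

Lemma frame_rcons P N y : frame B P N -> {in P ++ N, forall v, B y v = 0} ->
  B y y != 0 -> exists (c : C) P' N', [/\ frame B P' N',
    {subset P' ++ N' <= c *: y :: P ++ N} & (size P' + size N' = (size P + size N).+1)%N].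
Proof.
move=> fPN oy ny; have [c [_ nc]] := normalize ny.
have co : {in P ++ N, forall v, B (c *: y) v = 0}.
  by move=> v vF; rewrite hermZl oy ?mulr0.
case: nc => cc; [exists c, (P ++ [:: c *: y]), N|exists c, P, (N ++ [:: c *: y])];
  rewrite size_cat /=; split; try lia.
- exact: frame_rcons_pos.
- by move=> v; rewrite !(mem_cat, inE) -orbA => /or3P[]->; rewrite ?orbT.
- exact: frame_rcons_neg.
- by move=> v; rewrite !(mem_cat, inE) => /or3P[]->; rewrite ?orbT.
Qed.

Lemma orthogonal_ex F S : (size F < \dim S)%N ->
  exists n, [/\ n \in S, n != 0 & {in F, forall y, B n y = 0}].
Proof.
elim: F S => [|y F IH] S /= ltF.
  exists (vpick S); split=> //; first exact: memv_pick.
  by rewrite vpick0 -dimv_eq0 -lt0n.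
have [|n [/memv_capP[nS ny] nz oF]] := IH (S :&: orthov B <[y]>)%VS.
  by apply: leq_trans (leq_dim_orthov1 B y S); move: ltF; case: (\dim S).
exists n; split=> // v; rewrite inE => /orP[/eqP->|/oF//].
by apply/eqP; rewrite -mem_orthov1.
Qed.

(** Provides the direction [u + w] of a transvection that moves [x0 + y0]. The strict bound leaves
    room in [Y] for a non-isotropic [w] orthogonal to the frame; nondegeneracy of [X] gives a vector
    not orthogonal to [x0], whose norm is then adjusted to be opposite to that of [w]. *)
Lemma perturbation_vector X Y P N Q M x0 y0 :
  radical B X = 0%VS -> radical B Y = 0%VS ->
  frame B P N -> {subset P ++ N <= X} -> frame B Q M -> {subset Q ++ M <= Y} ->
  (size Q + size M < \dim Y)%N ->
  x0 \in X -> x0 != 0 -> B x0 x0 = 0 -> {in P ++ N, forall v, B x0 v = 0} ->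
  exists u w, [/\ u \in X, w \in Y, {in P ++ N, forall v, B u v = 0},
    {in Q ++ M, forall v, B w v = 0} &
    [/\ B u u + B w w = 0, B u u != 0 & B x0 u + B y0 w != 0]].
Proof.
move=> rX rY fPN sPN fQM sQM ltY x0X nx0 xx0 ox0.
have [P' [N' cX]] := frame_ext fPN sPN.
have [Q' [M' cY]] := frame_ext fQM sQM.
have spX := complete_span rX cX.
have [x [xX ox nx0x]] : exists x,
    [/\ x \in X, {in P ++ N, forall v, B x v = 0} & B x0 x != 0].
  have [x xF nx] : exists2 x, x \in P' ++ N' & B x0 x != 0.
    apply: contrapT => none; case/negP: nx0; apply/eqP.
    have [fX _ _] := cX.
    apply: (frame_span_orth0 fX); first by rewrite spX.
    move=> v; have := none; rewrite !mem_cat => none' vF; apply: contrapT => nv.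
    case/orP: vF => /orP[vF|vF].
    - by apply: nv; apply: ox0; rewrite mem_cat vF.
    - by apply: none; exists v; [rewrite mem_cat vF|apply/eqP].
    - by apply: nv; apply: ox0; rewrite mem_cat vF orbT.
    - by apply: none; exists v; [rewrite mem_cat vF orbT|apply/eqP].
  have [fX sX _] := cX; exists x; split=> //.
    by apply: sX; move: xF; rewrite !mem_cat => /orP[]->; rewrite ?orbT.
  move=> v vF; move: fX; rewrite frame_cat => /and3P[_ _ /allrelP oX].
  exact/herm0C/eqP/oX.
have [w [wY ow nw]] : exists w,
    [/\ w \in Y, {in Q ++ M, forall v, B w v = 0} & B w w != 0].
  have [_ _ dimY] := complete_decomp cY; rewrite rY dimv0 !size_cat addn0 in dimY.
  have [fY sY _] := cY; have [w wF] : exists w, w \in Q' ++ M'.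
    case: (Q' ++ M') (size_cat Q' M') => [/=|w F _]; first by lia.
    by exists w; rewrite mem_head.
  move: fY; rewrite frame_cat => /and3P[_ f' /allrelP oY].
  exists w; split; first by apply: sY; move: wF; rewrite !mem_cat => /orP[]->; rewrite ?orbT.
    by move=> v vF; apply/herm0C/eqP/oY.
  exact: (allP (frame_aniso f')).
(* Adding a multiple of the isotropic vector [x0] to [x] gives any prescribed
   real value to its norm. *)
pose c := B x0 x; pose s := - ((B w w + B x x) / 2) / c.
pose u := x + s *: x0.
have xu : B x0 u = c by rewrite /u hermDr hermZr xx0 mulr0 addr0.
have uu : B u u = - B w w.
  have sc : s * c = - ((B w w + B x x) / 2) by rewrite divfK.
  have scr : s^* * c^* = s * c.
    rewrite -rmorphM /= sc conj_Creal // rpredN rpredM ?rpredD ?herm_real //.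
    by rewrite rpredV realn.
  have xx0' : B x x0 = c^* by rewrite /c -herm_sym.
  rewrite /u !hermE xx0 -/c xx0' scr sc.
  by field.
have ou : {in P ++ N, forall v, B u v = 0}.
  by move=> v vF; rewrite /u hermDl hermZl ox // ox0 // mulr0 addr0.
have uX : u \in X by rewrite memvD // memvZ.
have nuu : B u u != 0 by rewrite uu oppr_eq0.
(* If the product vanished for both [w] and [- w], the sum of the two values, which is 2c, would be
   0. *)
have [s0|ns] := eqVneq (B x0 u + B y0 w) 0; last first.
  by exists u, w; split=> //; split=> //; rewrite uu addNr.
exists u, (- w); split=> //; first by rewrite memvN.
  by move=> v vF; rewrite -scaleN1r hermZl ow // mulr0.
rewrite -scaleN1r !hermZl !hermZr rmorphN1 mulN1r mulNr mul1r opprK uu addNr.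
split=> //; first by rewrite oppr_eq0.
apply/negP => /eqP d0; move: s0 d0; rewrite xu => s0 d0.
have : c *+ 2 = 0 by rewrite mulr2n -[RHS]addr0 -{1}s0 -d0; ring.
by move/eqP; rewrite mulrn_eq0 /=; apply/negP.
Qed.

(** The bound by [\dim S] gives a nonzero [n] in [S] orthogonal to the frame of the projection; its
    components are isotropic. The bounds by [\dim U] and [\dim W] leave room for [u] and [w]. The
    lifts of the frame are orthogonal to [e], hence fixed, while the component of [n] in [U] becomes
    non-isotropic and enlarges the frame. *)
Lemma index_growth U W S : splits B U W -> radical B U = 0%VS -> radical B W = 0%VS ->
  isotropic B S ->
  (posindex B (proj U W S) + negindex B (proj U W S) < minn (\dim S) (minn (\dim U) (\dim W)))%N ->
  exists e t0, B e e = 0 /\ forall t, t \is Num.real -> t != 0 -> t != t0 ->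
    forall T, T = (linfun (transv e t) @: S)%VS ->
    (posindex B (proj U W S) + negindex B (proj U W S) <
     posindex B (proj U W T) + negindex B (proj U W T))%N.
Proof.
move=> sUW rU rW iS; have [P [N cPN]] := complete_ex B (proj U W S).
have [-> ->] := complete_index cPN; rewrite !leq_min => /and3P[ltS ltU ltW].
case: (cPN) => fPN sPN radPN.
have [P' [N' [sPN' defP defN fQM]]] := frame_lift sUW iS fPN sPN.
have sPNU : {subset P ++ N <= U} by move=> v /sPN; apply/subvP/proj_subl.
pose p := daddv_pi U W; pose q := daddv_pi W U.
have sQMW : {subset map q N' ++ map q P' <= W}.
  by rewrite -map_cat => _ /mapP[y _ ->]; apply: memv_pi.
have [n [nS nz nPN]] := @orthogonal_ex (P ++ N) S ltac:(by rewrite size_cat).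
have opn : {in P ++ N, forall v, B (p n) v = 0}.
  move=> v vF; apply/herm0C; rewrite -(herm_pil sUW) ?sPNU //; exact/herm0C/nPN.
have pn_rad : p n \in radical B (proj U W S) by apply: radPN => //; apply: (pi_proj sUW).
have [pnS pn0] := mem_radicalP _ _ _ pn_rad.
have pnn : B (p n) (p n) = 0 by exact: pn0.
have pq := isotropic_pi sUW iS.
have qnn : B (q n) (q n) = 0 by apply/eqP; rewrite -oppr_eq0 -pq // pnn.
have oqn : {in map q N' ++ map q P', forall v, B (q n) v = 0}.
  move=> v; rewrite -map_cat => /mapP[s sF ->].
  have sS : s \in S by apply: sPN'; rewrite mem_cat orbC -mem_cat.
  apply/eqP; rewrite -oppr_eq0 -pq // pn0 //; exact: (pi_proj sUW).
have [u [w [uU wW ou ow [e0 nuu ne]]]] : exists u w, [/\ u \in U, w \in W,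
    {in P ++ N, forall v, B u v = 0}, {in map q N' ++ map q P', forall v, B w v = 0} &
    [/\ B u u + B w w = 0, B u u != 0 & B (p n) u + B (q n) w != 0]].
  (* If [n] has no component in [U], it has one in [W], and the two summands exchange roles. *)
  have [pz|npz] := eqVneq (p n) 0; last first.
    apply: perturbation_vector => //; last exact: memv_pi.
    by rewrite !size_map -(size_map p N') -(size_map p P') defP defN addnC.
  have nqz : q n != 0.
    by apply: contraNneq nz => qz; rewrite -(dpi_add sUW n) -/p -/q pz qz addr0.
  have [|w [u [wW uU ow ou [e0 nww ne]]]] := @perturbation_vector W U _ _ _ _ (q n) (p n)
      rW rU fQM sQMW fPN sPNU ltU _ nqz qnn oqn; first exact: memv_pi.
  exists u, w; split=> //; rewrite addrC; split=> //; last by rewrite addrC.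
  by apply: contraNneq nww => uu0; rewrite uu0 addr0 in e0; rewrite e0.
pose e := u + w.
have oUW : B u w = 0 by case: (sUW) => _ _ /orthovP; apply.
have ee : B e e = 0 by rewrite /e !hermE oUW (herm0C oUW) addr0 add0r.
have pe : p e = u by rewrite /e linearD /= /p (dpi_id sUW uU) (dpi_0 sUW wW) addr0.
have qe : q e = w.
  have sWU := splits_sym sUW.
  by rewrite /e linearD /= /q (dpi_0 sWU uU) (dpi_id sWU wW) add0r.
have Be v : B v e = B (p v) u + B (q v) w by rewrite (herm_pi sUW) -/p -/q pe qe.
pose c := B n e; have nc : c != 0 by rewrite /c Be.
pose d := B (p n) u.
(* The other root, besides 0, of the norm of the component in [U] of the moved [n]; there is no
   constant term since [p n] is isotropic. *)
pose t0 := - (('i * c * d^* - 'i * c^* * d) / (c * c^* * B u u)).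
exists e, t0; split=> // t tr nt ntt0 T defT.
have memT s : s \in S -> transv e t s \in T.
  by move=> sS; have := memv_img (linfun (transv e t)) sS; rewrite lfunE defT.
pose y := p (transv e t n).
have defy : y = p n + (t * 'i * c) *: u.
  by rewrite /y /transv linearD linearZ /= -/p pe.
have oy : {in P ++ N, forall v, B y v = 0}.
  by move=> v vF; rewrite defy hermDl hermZl opn // ou // mulr0 addr0.
have yy : B y y != 0.
  have -> : B y y = t * (c * c^* * B u u) * (t - t0).
    rewrite defy !hermE pnn -/d (herm_sym B u (p n)) -/d !rmorphM /= (conj_Creal tr) conjCi.
    have ii : - ('i * 'i) = 1 :> C by rewrite -expr2 sqrCi opprK.
    transitivity (t * ('i * c * d^* - 'i * c^* * d) +
        t ^+ 2 * (c * c^* * B u u) * - ('i * 'i)); first by ring.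
    by rewrite ii /t0; field; rewrite conjC_eq0 nc nuu.
  by rewrite !mulf_neq0 ?conjC_eq0 ?subr_eq0.
have [k [P1 [N1 [f1 s1 <-]]]] := frame_rcons fPN oy yy.
have fixT s : s \in P' ++ N' -> p s \in proj U W T.
  move=> sF; have sS := sPN' s sF.
  have psF : p s \in P ++ N by rewrite -defP -defN -map_cat map_f.
  have qsF : q s \in map q N' ++ map q P'.
    by rewrite -map_cat map_f // mem_cat orbC -mem_cat.
  have se : B s e = 0 by rewrite Be (herm0C (ou _ psF)) (herm0C (ow _ qsF)) addr0.
  rewrite -(transv_id t se); apply: (pi_proj sUW); exact: memT.
have sT : {subset P1 ++ N1 <= proj U W T}.
  move=> v /s1; rewrite inE => /orP[/eqP->|].
    by rewrite memvZ //; apply: (pi_proj sUW); apply: memT.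
  by rewrite -defP -defN -map_cat => /mapP[s sF ->]; apply: fixT.
have [le1 le2] := frame_index f1 sT.
exact: leq_add.
Qed.

End Transvections.

(** * Topology *)

Section Limits.
Variable C : numClosedFieldType.
Variables (T : Type) (D : set_system T).
Context {FD : Filter D}.

Lemma cvg_conj (f : T -> C) (a : C) : f @ D --> a -> (fun x => (f x)^*) @ D --> a^*.
Proof.
move/cvgrPdist_lt => fa; apply/cvgrPdist_lt => e e0; move: (fa _ e0).
by apply: filterS => x /=; rewrite -rmorphB norm_conjC.
Qed.

Lemma cvg_sum (I : Type) (s : seq I) (f : I -> T -> C) (a : I -> C) :
  (forall i, f i @ D --> a i) -> (fun x => \sum_(i <- s) f i x) @ D --> \sum_(i <- s) a i.
Proof.
move=> fa; elim: s => [|i s IH].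
  rewrite big_nil; under eq_fun do rewrite big_nil; exact: cvg_cst.
rewrite big_cons; under eq_fun do rewrite big_cons.
apply: cvgD; [exact: fa|exact: IH].
Qed.

End Limits.

Section Openness.
Variables (C : numClosedFieldType) (n : nat).
Local Notation vT := 'rV[C]_n.
Variable B : {hermitian vT for false & Num.conj}.
Implicit Types (X Y S U W : {vspace vT}).

(** Expanding along the elementary matrices exhibits a polynomial in the entries and their
    conjugates. *)
Lemma herm_continuous r (f g : {linear 'M[C]_(r, n) -> vT}) :
  continuous (fun M : 'M[C]_(r, n) => B (f M) (g M)).
Proof.
move=> A.
pose c (k l : 'I_r * 'I_n) := B (f (delta_mx k.1 k.2)) (g (delta_mx l.1 l.2)).
have expand : (fun M : 'M[C]_(r, n) => B (f M) (g M)) =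
    (fun M => \sum_k \sum_l M k.1 k.2 * (M l.1 l.2)^* * c k l).
  apply/funext => M; have dM : M = \sum_k M k.1 k.2 *: delta_mx k.1 k.2.
    by rewrite {1}[M]matrix_sum_delta pair_bigA.
  rewrite {1 2}dM (linear_sum f) (linear_sum g) herm_suml; apply: eq_bigr => k _.
  rewrite herm_sumr; apply: eq_bigr => l _.
  by rewrite (linearZ_LR f) (linearZ_LR g) hermZl hermZr mulrA.
rewrite expand /continuous_at.
have FA : Filter (nbhs A) by exact: nbhs_filter.
apply: (@cvg_sum C _ (nbhs A) FA) => k; apply: (@cvg_sum C _ (nbhs A) FA) => l.
apply: (@cvgM _ _ (nbhs A) FA); last exact: cvg_cst.
apply: (@cvgM _ _ (nbhs A) FA); first exact: coord_continuous.
apply: (@cvg_conj C _ (nbhs A) FA); exact: coord_continuous.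
Qed.

(** With s the sum of the |a_i|^2, the inequality |a_i a_j| <= (|a_i|^2 + |a_j|^2) / 2 bounds the
    deviation of [e * B v v] from s by b / (b + 1) times s. The tolerance 1 / (b + 1) makes this
    less than s, also for b = 0. Independence follows from positivity. *)
Lemma near_orthonormal_sdef (e : C) b (x : 'I_b -> vT) : e \is Num.real ->
  (forall i j, `|e * B (x i) (x j) - (i == j)%:R| < b.+1%:R^-1) ->
  sdef B e <<[tuple x i | i < b]>>%VS /\ \dim <<[tuple x i | i < b]>> = b.
Proof.
move=> er near_id.
have pos (a : 'I_b -> C) i0 : a i0 != 0 ->
    0 < e * B (\sum_i a i *: x i) (\sum_i a i *: x i).
  move=> ai0; pose s := \sum_i `|a i| ^+ 2.
  set v := \sum_i _; pose d := e * B v v - s.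
  have s_gt0 : 0 < s.
    rewrite /s (bigD1 i0) //= ltr_pwDl ?exprn_gt0 ?normr_gt0 // sumr_ge0 //.
  have d_real : d \is Num.real.
    by rewrite rpredB ?rpredM ?herm_real // ger0_real // ltW.
  have ltd : `|d| < s.
    have -> : d = \sum_i \sum_j a i * (a j)^* * (e * B (x i) (x j) - (i == j)%:R).
      rewrite /d /s /v herm_suml mulr_sumr -sumrB; apply: eq_bigr => i _.
      rewrite herm_sumr mulr_sumr.
      under [RHS]eq_bigr do rewrite mulrBr.
      rewrite sumrB; congr (_ - _).
        by apply: eq_bigr => j _; rewrite hermZl hermZr; ring.
      rewrite (bigD1 i) //= eqxx mulr1 big1 ?addr0 ?normCK // => j ji.
      by rewrite eq_sym (negPf ji) mulr0.
    apply: (@le_lt_trans _ _ (\sum_(i < b) \sum_(j < b)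
        (`|a i| ^+ 2 + `|a j| ^+ 2) / 2 * b.+1%:R^-1)).
      apply: le_trans (ler_norm_sum _ _ _) _; apply: ler_sum => i _.
      apply: le_trans (ler_norm_sum _ _ _) _; apply: ler_sum => j _.
      rewrite !normrM norm_conjC ler_pM ?mulr_ge0 ?normr_ge0 //; last exact: ltW.
      rewrite ler_pdivlMr ?ltr0n // -subr_ge0.
      have -> : `|a i| ^+ 2 + `|a j| ^+ 2 - `|a i| * `|a j| * 2 = (`|a i| - `|a j|) ^+ 2.
        by ring.
      by rewrite real_exprn_even_ge0 // rpredB ?normr_real.
    have -> : \sum_(i < b) \sum_(j < b) (`|a i| ^+ 2 + `|a j| ^+ 2) / 2 * b.+1%:R^-1 =
        b%:R / b.+1%:R * s.
      under eq_bigr => i _.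
        rewrite -!mulr_suml big_split /= sumr_const card_ord -/s; over.
      rewrite /= -!mulr_suml big_split /= sumr_const card_ord sumrMnl -/s -mulr_natl.
      by field; rewrite nat1r pnatr_eq0.
    by rewrite gtr_pMl // ltr_pdivrMr ?ltr0n // mul1r ltr_nat.
  by move: ltd; rewrite real_ltr_norml // => /andP[]; rewrite /d ltrBrDr addNr.
have coordE v : v \in <<[tuple x i | i < b]>>%VS ->
    exists a : 'I_b -> C, v = \sum_i a i *: x i.
  move=> /coord_span ->; exists (fun i => coord [tuple x i | i < b] i v).
  by apply: eq_bigr => i _; rewrite -tnth_nth tnth_mktuple.
split.
  move=> v /coordE[a ->] nz.
  have [[i ai]|none] := pselect (exists i, a i != 0); first exact: pos ai.
  case/negP: nz; rewrite big1 // => i _.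
  have [->|ai] := eqVneq (a i) 0; first by rewrite scale0r.
  by case: none; exists i.
rewrite -[RHS](size_tuple [tuple x i | i < b]); apply/eqnP/freeP => a a0 i.
apply: contraTeq isT => ai; have := pos a i ai.
move: a0; under eq_bigr do rewrite -tnth_nth tnth_mktuple.
by move=> ->; rewrite herm0l mulr0 ltxx.
Qed.

Lemma rowspanP r (A : 'M[C]_(r, n)) v :
  reflect (exists c : 'rV[C]_r, v = c *m A) (v \in rowspan A).
Proof.
apply: (iffP idP) => [vA|[c ->]].
  have : v \in limg (linfun (mulmxr A : 'rV[C]_r -> vT)).
    apply: (subvP _ _ vA); apply/span_subvP => _ /codomP[i ->].
    rewrite rowE -[_ *m _](lfunE (mulmxr A : 'rV[C]_r -> vT)).
    by apply: memv_img; rewrite memvf.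
  by case/memv_imgP=> c _ ->; exists c; rewrite lfunE.
rewrite mulmx_sum_row memv_suml // => i _.
by rewrite memvZ // memv_span // codom_f.
Qed.

(** Each [x i] is the projection of some [c i *m A]. With [c i] fixed, replacing [A] by [M] moves it
    continuously inside the projection of the row span, so the Gram matrix stays close to the
    identity. *)
Lemma near_sindex r U W (A : 'M[C]_(r, n)) (e : C) b (x : 'I_b -> vT) :
  splits B U W -> e \is Num.real ->
  (forall i, x i \in proj U W (rowspan A)) ->
  (forall i j, e * B (x i) (x j) = (i == j)%:R) ->
  \forall M \near A, (b <= sindex B e (proj U W (rowspan M)))%N.
Proof.
move=> sUW er xA gram.
have /choice[c xc] : forall i, exists c : 'rV[C]_r, x i = daddv_pi U W (c *m A).
  move=> i; move: (xA i); rewrite (proj_img sUW) => /memv_imgP[v /rowspanP[c ->] ->].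
  by exists c.
pose f i : {linear 'M[C]_(r, n) -> vT} := (daddv_pi U W \o mulmx (c i))%FUN.
have FA : Filter (nbhs A) by exact: nbhs_filter.
have : \forall M \near A, forall ij : 'I_b * 'I_b,
    `|e * B (f ij.1 M) (f ij.2 M) - (ij.1 == ij.2)%:R| < b.+1%:R^-1.
  apply: (@filter_forall _ _ _ (nbhs A) FA) => -[i j] /=.
  have : (fun M => e * B (f i M) (f j M)) @ A --> e * B (f i A) (f j A).
    apply: (@cvgM _ _ (nbhs A) FA); [exact: cvg_cst|exact: herm_continuous].
  move/cvgrPdist_lt => /(_ (b.+1%:R^-1)); rewrite invr_gt0 ltr0n => /(_ isT).
  apply: filterS => M; rewrite distrC /f /= -!xc gram.
  by [].
apply: filterS => M near_id.
have [|sd dimb] := @near_orthonormal_sdef e b (f^~ M) er.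
  by move=> i j; apply: (near_id (i, j)).
rewrite -{1}dimb; apply: sindex_ge sd; apply/span_subvP => _ /tnthP[i ->].
rewrite tnth_mktuple; apply: (pi_proj sUW); apply/rowspanP; by exists (c i).
Qed.

Lemma oseq_gram (e : C) F b : oseq B F -> all (fun v => e * B v v == 1) F ->
  (b <= size F)%N ->
  exists x : 'I_b -> vT, (forall i, x i \in F) /\
    (forall i j, e * B (x i) (x j) = (i == j)%:R).
Proof.
move=> oF nF leb; exists (fun i : 'I_b => F`_i).
have lt (i : 'I_b) : (i < size F)%N by apply: leq_trans leb.
split=> [i|i j]; first exact: mem_nth.
have [->|ij] := eqVneq i j; first by apply/eqP/(allP nF)/mem_nth.
have /(pairwiseP 0) o := oF.
have [lij|lij|/val_inj eij] := ltngtP i j; last by rewrite eij eqxx in ij.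
  by rewrite (eqP (o i j (lt i) (lt j) lij)) mulr0.
by rewrite (herm0C (eqP (o j i (lt j) (lt i) lij))) mulr0.
Qed.

Lemma open_Gr_index U W r b c : splits B U W -> open_in_Gr B r (Gr_index B U W r b c).
Proof.
move=> sUW; split; first by move=> S [].
(* The bounds are imposed on all matrices, isotropic or not, and define an open set of the whole
   matrix space. *)
exists [set A : 'M[C]_(r, n) | (b <= posindex B (proj U W (rowspan A)))%N /\
    (c <= negindex B (proj U W (rowspan A)))%N].
  rewrite openE => A /= [bA cA].
  have [P [N cPN]] := complete_ex B (proj U W (rowspan A)).
  have [sP sN] := complete_index cPN; rewrite sP in bA; rewrite sN in cA.
  case: cPN => /and3P[oPN nP nN] sPN _.
  move: oPN; rewrite oseq_cat => /and3P[_ oP oN].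
  have [|x [xP gx]] := @oseq_gram 1 P b oP _ bA.
    by apply/allP => v vP; rewrite mul1r (allP nP).
  have [|y [yN gy]] := @oseq_gram (-1) N c oN _ cA.
    by apply/allP => v vN; rewrite mulN1r eqr_oppLR (allP nN).
  have nx : \forall M \near A, (b <= sindex B 1 (proj U W (rowspan M)))%N.
    by apply: near_sindex gx => // i; rewrite sPN // mem_cat xP.
  have ny : \forall M \near A, (c <= sindex B (-1) (proj U W (rowspan M)))%N.
    apply: near_sindex gy => // i.
    by rewrite sPN // mem_cat yN orbT.
  rewrite /interior /=; move: nx ny; apply: filterS2 => M.
  by rewrite -posindexE -negindexE.
apply/seteqP; split=> A /=; first by case.
by case=> ? [].
Qed.

Lemma rowspan_ex r S : \dim S = r -> exists A : 'M[C]_(r, n), rowspan A = S.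
Proof.
move=> <-; exists (\matrix_(i < \dim S) (vbasis S)`_i).
rewrite -[RHS](span_basis (vbasisP S)); apply: eq_span => v; apply/codomP/(nthP 0).
  by case=> i ->; exists i; rewrite ?size_tuple // rowK.
by case=> i; rewrite size_tuple => lti <-; exists (Ordinal lti); rewrite rowK.
Qed.

Lemma rowspan_img r (h : 'End(vT)) (A A' : 'M[C]_(r, n)) :
  (forall i, row i A' = h (row i A)) -> rowspan A' = (h @: rowspan A)%VS.
Proof.
move=> rA; rewrite /rowspan limg_span !codomE -[in RHS]map_comp.
by congr (span _); apply: eq_map => i /=; apply: rA.
Qed.

Lemma open_line r (D : set 'M[C]_(r, n)) (A M : 'M[C]_(r, n)) : open D -> D A ->
  exists2 d : C, 0 < d & forall t, 0 < t -> t <= d -> D (A + t *: M).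
Proof.
move=> oD DA; have /nbhs_ballP[e /= e0 eD] := open_nbhs_nbhs (conj oD DA).
(* The term 1 keeps [K] positive and strictly larger than the modulus of every entry. *)
pose K := 1 + \sum_k `|M k.1 k.2|.
have K0 : 0 < K by rewrite ltr_pwDl ?ltr01 // sumr_ge0.
exists (e / K); first by rewrite divr_gt0.
move=> t t0 te; apply: eD; split=> // i j; rewrite -ball_normE /= !mxE.
rewrite opprD addNKr normrN normrM (gtr0_norm t0).
apply: lt_le_trans (_ : t * K <= e); last by rewrite -ler_pdivlMr.
rewrite ltr_pM2l // /K (bigD1 (i, j)) //= addrCA ltrDl.
by rewrite ltr_pwDl ?ltr01 // sumr_ge0.
Qed.

(** Transvections move a frame of [S] along a line, on which [D] contains an initial segment. The
    matrices there span isotropic subspaces, which would lie in the orbit of [S]; yet some have a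
    larger index sum, which is constant on orbits. *)
Lemma Horbit_not_open U W r S : splits B U W ->
  radical B U = 0%VS -> radical B W = 0%VS -> Gr B r S ->
  (posindex B (proj U W S) + negindex B (proj U W S) <
     minn r (minn (\dim U) (\dim W)))%N ->
  ~ open_in_Gr B r (Horbit B U W S).
Proof.
move=> sUW rU rW SGr; case: (SGr) => dS iS; rewrite -{1}dS => lt [_ [D oD eqD]].
have [e [t0 [ee grow]]] := index_growth sUW rU rW iS lt.
have [A rA] := rowspan_ex dS.
have DA : D A.
  have : (@rowspan C n r @^-1` Horbit B U W S) A.
    rewrite /preimage /= rA; exact: Horbit_refl.
  by rewrite eqD => -[].
pose M : 'M[C]_(r, n) := \matrix_i (('i * B (row i A) e) *: e).
have [d d0 dD] := open_line M oD DA.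
(* The numbers [d] and [d / 2] cannot both be the excluded value [t0]. *)
have [t [tgt tle tn]] : exists t, [/\ 0 < t, t <= d & t != t0].
  have [->|nd] := eqVneq t0 d; last by exists d; rewrite eq_sym.
  exists (d / 2); split; first by rewrite divr_gt0.
    by rewrite ler_pdivrMr ?ltr0n // ler_peMr ?ler1n // ltW.
  by rewrite lt_eqF // ltr_pdivrMr ?ltr0n // ltr_pMr ?ltr1n.
pose T := (linfun (transv B e t) @: S)%VS.
have tr : t \is Num.real by rewrite ger0_real // ltW.
have rT : rowspan (A + t *: M) = T.
  rewrite /T -rA; apply: rowspan_img => i; rewrite lfunE /= /transv.
  rewrite linearD linearZ /= rowK scalerA mulrA //.
have T_Gr : Gr B r T.
  have hB u v : B (linfun (transv B e t) u) (linfun (transv B e t) v) = B u v.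
    by rewrite !lfunE; apply: transv_herm.
  split.
    rewrite limg_dim_eq //; apply/eqP; rewrite -subv0; apply/subvP => v.
    rewrite memv_cap memv_ker lfunE memv0 => /andP[_ /eqP tv0].
    have ve : B v e = 0.
      have te : transv B e t e = e by rewrite transv_id.
      by rewrite -(transv_herm v e ee tr) tv0 herm0l.
    by apply/eqP; rewrite -[LHS](transv_id t ve).
  apply/isotropicP => _ _ /memv_imgP[u uS ->] /memv_imgP[v vS ->].
  by rewrite hB (isotropicP _ _ iS).
have : (@rowspan C n r @^-1` Horbit B U W S) (A + t *: M).
  by rewrite eqD; split; [rewrite /= rT|exact: dD].
case=> h hH; rewrite rT => hS.
have := grow t tr (lt0r_neq0 tgt) tn T erefl.
rewrite -hS (inH_proj _ sUW hH).
have [-> ->] := img_index (proj U W S) (inH_herm sUW hH).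
by rewrite ltnn.
Qed.

End Openness.

(** * Classification of the open orbits *)

Local Open Scope nat_scope.

Theorem corollary6p4 (R : realType) (p q p1 q1 r : nat)
    (B : {hermitian 'rV[Cplx R]_(p + q) for false & Num.conj})
    (U W : {vspace 'rV[Cplx R]_(p + q)}) :
  nondegenerate B -> has_signature B fullv p q ->
  (U + W)%VS = fullv -> (U :&: W)%VS = 0%VS -> (U <= orthov B W)%VS ->
  has_signature B U p1 q1 -> has_signature B W (p - p1) (q - q1) ->
  0 < p1 < p -> 0 < q1 < q -> r <= minn p q ->
  let mU := minn p1 (q - q1) in
  let mW := minn q1 (p - p1) in
  (r < mU + mW ->
     (0 < r -> exists O1 O2 : set {vspace 'rV[Cplx R]_(p + q)},
        [/\ open_Horbits B U W r O1, open_Horbits B U W r O2 & O1 <> O2]) /\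
     open_Horbits B U W r =
       [set O | exists bU bW : nat,
          [/\ bU + bW = r, 0 <= bU <= mU, 0 <= bW <= mW &
              O = Orb B U W r 0 0 0 bU bW]]) /\
  (mU + mW <= r ->
     open_Horbits B U W r =
       [set if \dim W < \dim U
            then Orb B U W r (r - mU - mW) 0 0 mU mW
            else Orb B U W r 0 (r - mU - mW) 0 mU mW]).
Proof.
move=> _ _ addUW capUW oUW sigU sigW /andP[p1_gt0 ltp] /andP[q1_gt0 ltq] ler mU mW.
have sUW : splits B U W by [].
have lep := ltnW ltp; have leq := ltnW ltq.
have [[[dimU _ _] [dimW _ _]] [rU rW]] :=
  ((sigU, sigW), (signature_radical sigU, signature_radical sigW)).
have index_ge S : open_in_Gr B r (Horbit B U W S) -> Gr B r S ->
    minn r (mU + mW) <= posindex B (proj U W S) + negindex B (proj U W S).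
  move=> oS SGr; rewrite leqNgt; apply/negP => lt.
  case: (Horbit_not_open sUW rU rW SGr _ oS); apply: leq_trans lt _.
  (* Here [mU + mW] is the least of dim U, dim W, p and q, and the last two are at least [r]. *)
  by rewrite dimU dimW /mU /mW; lia.
split=> [ltr|ler'].
  have open_orbit b c : b + c = r -> b <= mU -> c <= mW ->
      open_Horbits B U W r (Orb B U W r 0 0 0 b c).
    move=> bc leb lec; rewrite (Orb_small sUW bc); split; first exact: open_Gr_index.
    have [|S SG] := Gr_index_nonempty sUW sigU sigW lep leq ler leb lec; first by rewrite bc.
    exists S; first by case: SG.
    by rewrite (Horbit_small sUW sigU sigW bc SG).
  split=> [r_gt0|].
    (* The largest and the smallest admissible values of b_U, distinct because [r] lies strictly
       between 0 and [mU + mW]. For [r = 0] the only isotropic subspace is 0, with a single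
       orbit. *)
    pose b1 := minn r mU; pose b2 := r - minn r mW.
    have mU_gt0 : 0 < mU by rewrite /mU; lia.
    have mW_gt0 : 0 < mW by rewrite /mW; lia.
    have O1 : open_Horbits B U W r (Orb B U W r 0 0 0 b1 (r - b1)).
      by apply: open_orbit; rewrite /b1; lia.
    have O2 : open_Horbits B U W r (Orb B U W r 0 0 0 b2 (r - b2)).
      by apply: open_orbit; rewrite /b2; lia.
    exists (Orb B U W r 0 0 0 b1 (r - b1)), (Orb B U W r 0 0 0 b2 (r - b2)).
    split=> // eqO; case: O1 => _ [S _ SO].
    have S1 : Orb B U W r 0 0 0 b1 (r - b1) S.
      by rewrite SO; exact: Horbit_refl.
    have S2 : Orb B U W r 0 0 0 b2 (r - b2) S by rewrite -eqO.
    case: S1 S2 => _ [_ _ _ e1 _] [_ [_ _ _ e2 _]].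
    by move: e1; rewrite e2 /b1 /b2; lia.
  apply/seteqP; split=> [X [HO [S SGr defX]]|X [b [c [bc /andP[_ leb] /andP[_ lec] ->]]]].
    have iS : isotropic B S by case: SGr.
    have [leb lec] := index_bounds sUW sigU sigW iS.
    rewrite defX in HO; have ge := index_ge S HO SGr.
    have le := index_sum_le S sUW; rewrite (proj1 SGr) in le.
    exists (posindex B (proj U W S)), (negindex B (proj U W S)).
    have full : posindex B (proj U W S) + negindex B (proj U W S) = r.
      apply/eqP; rewrite eqn_leq le (leq_trans _ ge) // leq_min leqnn.
      exact: ltnW.
    split=> //; rewrite (Orb_small sUW full) defX.
    by apply: (Horbit_small sUW sigU sigW full).
  exact: open_orbit.
rewrite (Orb_large sUW sigU sigW lep leq ler ler').
apply/seteqP; split=> [X [HO [S SGr defX]]|_ ->].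
  have iS : isotropic B S by case: SGr.
  have [leb lec] := index_bounds sUW sigU sigW iS.
  rewrite defX in HO; have ge := index_ge S HO SGr.
  rewrite /= defX; apply: (Horbit_large sUW sigU sigW lep leq ler ler').
  (* Neither index exceeds its bound and their sum is at least [mU + mW], so both bounds are
     attained. *)
  have [geb gec] : mU <= posindex B (proj U W S) /\ mW <= negindex B (proj U W S).
    move: ge leb lec; rewrite (minn_idPr ler') -/mU -/mW.
    by move: (posindex _ _) (negindex _ _) => a b; lia.
  by split.
split; first exact: open_Gr_index.
have [S SG] := Gr_index_nonempty sUW sigU sigW lep leq ler (leqnn _) (leqnn _) ler'.
exists S; first by case: SG.
by rewrite (Horbit_large sUW sigU sigW lep leq ler ler' SG).
Qed.
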